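(* Let $(R,\mathfrak{m})$ be a local $F$-finite Gorenstein ring of prime characteristic $p$ and let $Q\subsetneq R$ be an ideal. Consider the following three conditions: (1) For any $c$ not in any minimal prime of $Q$, there exists $e>0$ such that $c\,(Q^{[p^e]}:Q)\nsubseteq I_e(\mathfrak{m})$. (2) For any $c$ not in any minimal prime of $Q$, there exists $e>0$ such that $c\,(I_e(Q):Q)\nsubseteq I_e(\mathfrak{m})$. (3) $R/Q$ is strongly $F$-regular. Then $(1)\Rightarrow(2)\Rightarrow(3)$, and moreover $(3)\Rightarrow(1)$ if $\operatorname{pd}_R(R/Q)<\infty$.
   Context: All rings are commutative, Noetherian, with unity, of prime characteristic $p>0$. $F^e_*R$ denotes $R$ viewed as an $R$-module via the $e$-th iterate of Frobenius; its elements are written $F^e_*r$. $R$ is $F$-finite if $F^e_*R$ is a finite $R$-module. An $F$-finite ring $A$ is strongly $F$-regular if for every $c\in A$ not in any minimal prime of $A$ there is $e>0$ such that the $A$-linear map $A\to F^e_*A$ sending $1$ to $F^e_*c$ splits. For an ideal $Q$, $Q^{[p^e]}$ is the ideal generated by the $p^e$-th powers of elements of $Q$, and $I_e(Q)=\{r\in R:\varphi(F^e_*r)\in Q\text{ for all }\varphi\in\operatorname{Hom}_R(F^e_*R,R)\}$. *)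

(* Defs.v *)
From HB Require Import structures.
From mathcomp Require Import all_boot all_order all_algebra.
From mathcomp Require Import generic_quotient ring_quotient.
From mathcomp Require Import boolp classical_sets.

Set Implicit Arguments.
Unset Strict Implicit.
Unset Printing Implicit Defensive.

Import GRing.Theory.
Local Open Scope ring_scope.
Local Open Scope classical_set_scope.
Local Open Scope quotient_scope.

(* Ideals are classical sets [I : set R]. The library structure [idealr R]
   (bundled proper ideals) is used only where a quotient ring is formed; the
   set underlying [Q : idealr R] is [[set` Q]]. *)

Section Ideals.
Variable R : comNzRingType.
Implicit Types I J P M : set R.

Definition is_ideal I : Prop :=
  [/\ I 0, forall x y, I x -> I y -> I (x + y) & forall a x, I x -> I (a * x)].

Definition is_prime_ideal P : Prop :=
  [/\ is_ideal P, ~ P 1 & forall x y, P (x * y) -> P x \/ P y].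

Definition is_maximal_ideal M : Prop :=
  [/\ is_ideal M, ~ M 1 &
      forall J, is_ideal J -> ~ J 1 -> M `<=` J -> J = M].

Definition minimal_prime I P : Prop :=
  [/\ is_prime_ideal P, I `<=` P &
      forall P', is_prime_ideal P' -> I `<=` P' -> P' `<=` P -> P' = P].

Definition outside_minimal_primes I (c : R) : Prop :=
  forall P, minimal_prime I P -> ~ P c.

Definition colon I J : set R := [set r | forall x, J x -> I (r * x)].

Definition scale_set (c : R) I : set R := [set c * x | x in I].

Definition ideal_generated (S : set R) : set R := smallest is_ideal S.

Definition frobenius_power (q : nat) I : set R :=
  ideal_generated [set x ^+ q | x in I].

End Ideals.

Definition noetherian (R : comNzRingType) : Prop :=
  forall I : set R, is_ideal I ->
    exists (n : nat) (g : 'I_n -> R),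
      I = [set x | exists c : 'I_n -> R, x = \sum_(i < n) c i * g i].

Definition local_ring (R : comNzRingType) (m : set R) : Prop :=
  is_maximal_ideal m /\ forall m', is_maximal_ideal m' -> m' = m.

Section Modules.
Variable R : comNzRingType.

Definition finite_module (M : lmodType R) : Prop :=
  exists (n : nat) (g : 'I_n -> M),
    forall x : M, exists c : 'I_n -> R, x = \sum_(i < n) c i *: g i.

Definition surjective_map (A B : Type) (f : A -> B) : Prop :=
  forall y, exists x, f x = y.

Definition exact_at (A B C : lmodType R) (f : A -> B) (g : B -> C) : Prop :=
  forall y : B, g y = 0 <-> exists x : A, f x = y.

Definition zero_module (M : lmodType R) : Prop := forall x : M, x = 0.

Definition projective_module (P : lmodType R) : Prop :=
  forall (A B : lmodType R) (f : {linear A -> B}) (g : {linear P -> B}),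
    surjective_map f -> exists h : {linear P -> A}, forall x, f (h x) = g x.

Definition injective_module (E : lmodType R) : Prop :=
  forall (A B : lmodType R) (f : {linear A -> B}) (g : {linear A -> E}),
    injective f -> exists h : {linear B -> E}, forall x, h (f x) = g x.

(* 0 -> P_n -> ... -> P_1 -> P_0 -> M -> 0 *)
Definition finite_projective_dimension (M : lmodType R) : Prop :=
  exists (n : nat) (P : nat -> lmodType R)
    (d : forall i, {linear P i.+1 -> P i}) (eps : {linear P 0%N -> M}),
    [/\ forall i, projective_module (P i),
        forall i, (n < i)%N -> zero_module (P i),
        surjective_map eps,
        exact_at (d 0%N) eps &
        forall i, exact_at (d i.+1) (d i)].

(* 0 -> M -> E^0 -> E^1 -> ... -> E^n -> 0 *)
Definition finite_injective_dimension (M : lmodType R) : Prop :=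
  exists (n : nat) (E : nat -> lmodType R)
    (eta : {linear M -> E 0%N}) (d : forall i, {linear E i -> E i.+1}),
    [/\ forall i, injective_module (E i),
        forall i, (n < i)%N -> zero_module (E i),
        injective eta,
        exact_at eta (d 0%N) &
        forall i, exact_at (d i) (d i.+1)].

End Modules.

(* To be used for Noetherian local rings only: a general Noetherian ring is
   Gorenstein when its localizations are. *)
Definition gorenstein_local (R : comNzRingType) : Prop :=
  finite_injective_dimension (R^o : lmodType R).

(* F^e_* R, with R-action a *: F^e_* r = F^e_* (a ^+ (p ^ e) * r). The parameters
   [chRp] and [e] do not affect the carrier; they select the scaling. *)
Definition Fstar (R : comNzRingType) (p : nat) (chRp : p \in [pchar R])
  (e : nat) : Type := R.

Section FrobeniusPushforward.
Variables (R : comNzRingType) (p : nat) (chRp : p \in [pchar R]) (e : nat).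

Local Notation FeR := (Fstar chRp e).

HB.instance Definition _ := GRing.Zmodule.on FeR.

Definition Fstar_elt (r : R) : FeR := r.

Definition Fstar_scale (a : R) (x : FeR) : FeR := a ^+ (p ^ e) * (x : R).

Fact Fstar_scaleA a b x : Fstar_scale a (Fstar_scale b x) = Fstar_scale (a * b) x.
Proof. by rewrite /Fstar_scale exprMn mulrA. Qed.

Fact Fstar_scale1 : left_id 1 Fstar_scale.
Proof. by move=> x; rewrite /Fstar_scale expr1n mul1r. Qed.

Fact Fstar_scaleDr : right_distributive Fstar_scale +%R.
Proof. by move=> a x y; rewrite /Fstar_scale mulrDr. Qed.

Fact Fstar_scaleDl x : {morph Fstar_scale^~ x : a b / a + b}.
Proof.
move=> a b; rewrite /Fstar_scale exprDn_pchar ?mulrDl //.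
by rewrite pnatX (pnatE _ (pcharf_prime chRp)) chRp.
Qed.

HB.instance Definition _ := GRing.Zmodule_isLmodule.Build R FeR
  Fstar_scaleA Fstar_scale1 Fstar_scaleDr Fstar_scaleDl.

End FrobeniusPushforward.

Section FSingularities.
Variables (R : comNzRingType) (p : nat) (chRp : p \in [pchar R]).

Definition F_finite : Prop :=
  forall e : nat, finite_module (Fstar chRp e : lmodType R).

Definition I_ (e : nat) (Q : set R) : set R :=
  [set r | forall phi : {linear Fstar chRp e -> R^o}, Q (phi (Fstar_elt chRp e r))].

Definition strongly_F_regular : Prop :=
  F_finite /\
  forall c : R, outside_minimal_primes [set 0] c ->
    exists2 e : nat, (0 < e)%N &
      exists phi : {linear Fstar chRp e -> R^o},
        cancel (fun a : R => a *: Fstar_elt chRp e c) phi.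

End FSingularities.

Section IdealQuotient.
Variables (R : comNzRingType) (Q : idealr R).

Fact ideal_quot_pchar (p : nat) :
  p \in [pchar R] -> p \in [pchar {ideal_quot Q}].
Proof. exact: (rmorph_pchar \pi_{ideal_quot Q}). Qed.

(* The underlying additive group of R/Q, carrying its R-module structure. *)
Definition quot_module : Type := {ideal_quot Q}.

HB.instance Definition _ := GRing.Zmodule.on quot_module.

Definition quot_scale (a : R) (x : quot_module) : quot_module :=
  \pi_{ideal_quot Q} a * (x : {ideal_quot Q}).

Fact quot_scaleA a b x : quot_scale a (quot_scale b x) = quot_scale (a * b) x.
Proof. by rewrite /quot_scale mulrA rmorphM. Qed.

Fact quot_scale1 : left_id 1 quot_scale.
Proof. by move=> x; rewrite /quot_scale rmorph1 mul1r. Qed.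

Fact quot_scaleDr : right_distributive quot_scale +%R.
Proof. by move=> a x y; rewrite /quot_scale mulrDr. Qed.

Fact quot_scaleDl x : {morph quot_scale^~ x : a b / a + b}.
Proof. by move=> a b; rewrite /quot_scale rmorphD mulrDl. Qed.

HB.instance Definition _ := GRing.Zmodule_isLmodule.Build R quot_module
  quot_scaleA quot_scale1 quot_scaleDr quot_scaleDl.

End IdealQuotient.

(* Main.v *)
Require Import Defs.
From HB Require Import structures.
From mathcomp Require Import all_boot all_order all_algebra.
From mathcomp Require Import generic_quotient ring_quotient.
From mathcomp Require Import boolp classical_sets.
From mathcomp Require Import freeg ring.

Set Implicit Arguments.
Unset Strict Implicit.
Unset Printing Implicit Defensive.

(** Write [q = p ^ e] and [S] for [Fstar chRp e].

    cond1 implies cond2 because [x ^+ q] acts on [S] as the scalar [x], so that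
    [Q^[q]] lies in [I_e(Q)] ([frobenius_power_sub_I]).  For cond2 implies
    cond3, take [r] with [r Q] inside [I_e(Q)] and [phi : S -> R] with
    [phi (c r)] a unit: the map [phi (r .)] sends [Q] to [Q], and the map that
    it induces over [R/Q] sends [c] to a unit ([colon_descends]).

    For cond3 implies cond1, let [phi] over [R/Q] send [c] to [1].  Two facts
    about the Gorenstein ring [R] are needed ([gorenstein_Fstar]).

    - [Ext^i_R(S, R) = 0] for [i > 0].  When [R/Q] has finite projective
      dimension this gives [Ext^1_R(S, K) = 0] for [K] a syzygy of [R/Q]; hence
      [phi] lifts to [h : S -> R], and every map [S -> R] with values in [Q] is a
      combination of maps [S -> R] with coefficients in [Q].
    - [Hom_R(S, R)] is generated over [S] by one map [f0].

    Write [h = f0 (r .)].  For [w] in [Q] the map [h (w .)] has values in [Q], so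
    [f0 (r w .) = f0 (z .)] with [z] in [Q^[q]].  Since [h (c)] is a unit, [f0] is
    faithful; so [r w = z] and [r] lies in [Q^[q] : Q], while
    [f0 (c r) = h (c)] is not in [m] ([strongly_F_regular_colon]).

    Both facts come from a regular sequence [s] of length [t] in [m] that is
    maximal, so that [m u] lies in [J = (s)] for some [u] outside [J].  Cohomology
    of [Hom(-, C)], for [C] an injective resolution of [R], vanishes in degrees
    above [t] for all finite modules ([Ext_vanish_finite]); since the [q]-th
    powers of [s] are again a regular sequence, [s] is regular on [S] and the
    vanishing goes down to all positive degrees ([Ext_vanish_full_depth]).  In
    degree [t] the cohomology of [R/J] is [R/J] itself ([Ext_free1_mod_seq]),
    which makes [R/J] self-injective ([quotient_self_injective]); likewise for
    the ideal [J'] of the [q]-th powers.  The socle of [R/J'] is then cyclic, and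
    duality between [S/J'] and its maps to [R/J] shows that a map that does not
    kill this socle generates [Hom_R(S, R)] modulo [m], hence generates it by
    Nakayama's lemma ([hom_Fstar_cyclic]). *)

Import GRing.Theory.
Local Open Scope ring_scope.
Local Open Scope classical_set_scope.

(** * Linear maps and submodules *)

Section LinearAlgebra.
Variable R : comNzRingType.
Implicit Types M L E P : lmodType R.

Definition is_submod M (N : set M) : Prop :=
  [/\ N 0, forall x y, N x -> N y -> N (x + y) & forall a x, N x -> N (a *: x)].

Definition kills M E (N : set M) (f : M -> E) : Prop :=
  forall x, N x -> f x = 0.

Lemma submodN M (N : set M) x : is_submod N -> N x -> N (- x).
Proof. by move=> [_ _ NZ] Nx; rewrite -scaleN1r; exact: NZ. Qed.

Lemma submodB M (N : set M) x y : is_submod N -> N x -> N y -> N (x - y).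
Proof. by move=> sN Nx Ny; case: (sN) => _ ND _; apply: ND => //; exact: submodN. Qed.

Lemma submod_sum M (N : set M) I (r : seq I) (P : pred I) (F : I -> M) :
  is_submod N -> (forall i, P i -> N (F i)) -> N (\sum_(i <- r | P i) F i).
Proof. by move=> [N0 ND _] NF; apply: big_ind. Qed.

Lemma submod0 M : is_submod [set 0 : M].
Proof.
by split=> //= [x y -> ->|a x ->]; rewrite ?addr0 ?scaler0.
Qed.

Lemma submodT M : is_submod [set: M].
Proof. by []. Qed.

Lemma submod_preim M L (f : {linear M -> L}) (N : set L) :
  is_submod N -> is_submod [set x | N (f x)].
Proof.
move=> [N0 ND NZ]; split=> /=; first by rewrite linear0.
- by move=> x y Nx Ny; rewrite linearD; exact: ND.
- by move=> a x Nx; rewrite linearZ; exact: NZ.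
Qed.

Definition add_im M L (N : set M) (f : L -> M) : set M :=
  [set y | exists n x, N n /\ y = n + f x].

Lemma submod_add_im M L (N : set M) (f : {linear L -> M}) :
  is_submod N -> is_submod (add_im N f).
Proof.
move=> [N0 ND NZ]; split.
- by exists 0, 0; rewrite linear0 addr0.
- move=> _ _ [n [x [Nn ->]]] [n' [x' [Nn' ->]]]; exists (n + n'), (x + x').
  by split; [exact: ND|rewrite linearD addrACA].
- move=> a _ [n [x [Nn ->]]]; exists (a *: n), (a *: x).
  by split; [exact: NZ|rewrite linearZ scalerDr].
Qed.

Lemma sub_add_im M L (N : set M) (f : {linear L -> M}) x : N x -> add_im N f x.
Proof. by move=> Nx; exists x, 0; rewrite linear0 addr0. Qed.

Lemma im_add_im M L (N : set M) (f : {linear L -> M}) x :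
  is_submod N -> add_im N f (f x).
Proof. by case=> N0 _ _; exists 0, x; rewrite add0r. Qed.

Definition lin_of M L (f : M -> L) (H : linear f) : {linear M -> L} :=
  HB.pack f (GRing.isLinear.Build R M L *:%R f H).

Lemma lin_ofE M L (f : M -> L) (H : linear f) x : lin_of H x = f x.
Proof. by []. Qed.

Lemma lin_ex M L (f : M -> L) : linear f -> exists g : {linear M -> L}, g =1 f.
Proof. by move=> H; exists (lin_of H). Qed.

Fact scal_linear M (a : R) : linear (fun x : M => a *: x).
Proof. by move=> b x y; rewrite scalerDr !scalerA mulrC. Qed.
Definition scal M a : {linear M -> M} := lin_of (@scal_linear M a).

Fact gen_linear M (x : M) : linear (fun a : R^o => a *: x).
Proof. by move=> b u v; rewrite scalerDl scalerA. Qed.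
Definition gen M (x : M) : {linear R^o -> M} := lin_of (gen_linear x).

Fact comb_linear M n (w : 'I_n -> M) :
  linear (fun b : 'rV[R]_n => \sum_j b 0 j *: w j).
Proof.
move=> a b c; rewrite scaler_sumr -big_split; apply: eq_bigr => j _.
by rewrite !mxE scalerDl scalerA.
Qed.
Definition comb M n (w : 'I_n -> M) : {linear 'rV[R]_n -> M} :=
  lin_of (comb_linear w).

Lemma combE M n (f : {linear 'rV[R]_n -> M}) b :
  f b = \sum_j b 0 j *: f (delta_mx 0 j).
Proof.
by rewrite {1}[b]row_sum_delta linear_sum; apply: eq_bigr => j _; rewrite linearZ.
Qed.

Lemma comb_delta M n (w : 'I_n -> M) j : comb w (delta_mx 0 j) = w j.
Proof.
rewrite /= (bigD1 j) //= mxE !eqxx scale1r big1 ?addr0 // => i ij.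
by rewrite mxE eqxx (negPf ij) scale0r.
Qed.

Fact sum_linear M E r (c : 'I_r -> R) (z : 'I_r -> {linear M -> E}) :
  linear (fun x => \sum_k c k *: z k x).
Proof.
move=> a x y; rewrite scaler_sumr -big_split; apply: eq_bigr => k _.
by rewrite linearP scalerDr !scalerA mulrC.
Qed.
Definition sum_lin M E r c z : {linear M -> E} := lin_of (@sum_linear M E r c z).

(** Submodules are sets, whereas injectivity is tested on modules: a submodule
    is turned into a module here. *)
Section SubmoduleType.
Variables (M : lmodType R) (A : set M) (sA : is_submod A).
Definition submod_pred : {pred M} := fun x => `[< A x >].
Fact submod_pred_closed : submod_closed submod_pred.
Proof.
case: sA => A0 AD AZ; split; first exact/asboolP.
by move=> a x y /asboolP Ax /asboolP Ay; apply/asboolP/AD => //; exact: AZ.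
Qed.
Definition keyed_submod (_ : is_submod A) := submod_pred.
HB.instance Definition _ :=
  GRing.isSubmodClosed.Build R M (keyed_submod sA) submod_pred_closed.
Record submod_type := SubmodType {
  submod_val : M ; _ : submod_val \in keyed_submod sA }.
HB.instance Definition _ := [isSub for submod_val].
HB.instance Definition _ := [Choice of submod_type by <:].
HB.instance Definition _ := [SubChoice_isSubLmodule of submod_type by <:].

Lemma submod_typeP : exists (X : lmodType R) (v : {linear X -> M}),
  injective v /\ forall x, A x <-> exists y, v y = x.
Proof.
exists submod_type, val; split; first exact: val_inj.
move=> x; split=> [Ax|[y <-]]; last exact/asboolP/(valP y).
have Px : x \in keyed_submod sA by apply/asboolP.
by exists (SubmodType Px).
Qed.
End SubmoduleType.

(** A linear partial map is given by its graph [G], so that being well defined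
    is a condition at [0] only. *)
Lemma injective_extension M E (G : M -> E -> Prop) :
    injective_module E ->
    G 0 0 -> (forall a x e y f, G x e -> G y f -> G (a *: x + y) (a *: e + f)) ->
    (forall e, G 0 e -> e = 0) ->
  exists w : {linear M -> E}, forall x e, G x e -> w x = e.
Proof.
move=> injE G0 GL Gf.
have uniqG x e f : G x e -> G x f -> e = f.
  move=> Ge Gf'; apply/eqP; rewrite -subr_eq0; apply/eqP/Gf.
  have := GL (-1) _ _ _ _ Gf' Ge.
  by rewrite !scaleN1r addNr addrC.
pose D : set M := [set x | exists e, G x e].
have sD : is_submod D.
  split=> [|x y [e Ge] [f Gf']|a x [e Ge]]; first by exists 0.
  - by exists (1 *: e + f); have := GL 1 _ _ _ _ Ge Gf'; rewrite !scale1r.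
  - by exists (a *: e + 0); have := GL a _ _ _ _ Ge G0; rewrite addr0.
have [X [v [vinj vP]]] := submod_typeP sD.
have hP y : exists e, G (v y) e by apply/(vP (v y)); exists y.
pose h y := projT1 (cid (hP y)).
have Gh y : G (v y) (h y) by exact: (projT2 (cid (hP y))).
have hlin : linear h.
  by move=> a x y; apply: (uniqG _ _ _ (Gh _)); rewrite linearP; exact: GL.
have [h' h'E] := lin_ex hlin.
have [w wP] := injE _ _ v h' vinj.
exists w => x e Gx.
have /vP [y yx] : D x by exists e.
rewrite -yx wP h'E; apply: (uniqG (v y)) => //; by rewrite yx.
Qed.

Lemma factor_surjection L M E (b : {linear L -> M}) (v : {linear L -> E}) :
    surjective_map b -> (forall x, b x = 0 -> v x = 0) ->
  exists w : {linear M -> E}, forall x, w (b x) = v x.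
Proof.
move=> bs kv.
pose s y := projT1 (cid (bs y)).
have sP y : b (s y) = y := projT2 (cid (bs y)).
have vE x y : b x = b y -> v x = v y.
  move=> bxy; apply/eqP; rewrite -subr_eq0 -linearB; apply/eqP/kv.
  by rewrite linearB bxy subrr.
have [w wE] : exists w : {linear M -> E}, w =1 (fun y => v (s y)).
  by apply: lin_ex => a x y; rewrite -linearP; apply: vE; rewrite linearP !sP.
by exists w => x; rewrite wE; apply: vE; rewrite sP.
Qed.

(** A linear map from [M] to the quotient [P/K], given by representatives of
    its values. *)
Definition linear_mod M P (K : set P) (mu : M -> P) : Prop :=
  forall a x y, K (mu (a *: x + y) - (a *: mu x + mu y)).

Lemma linear_mod0 M P (K : set P) (mu : M -> P) :
  is_submod K -> linear_mod K mu -> K (mu 0).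
Proof.
move=> sK muP; have := submodN sK (muP 1 0 0).
by rewrite !scale1r addr0 opprB addrK.
Qed.

Lemma linear_mod_sum M P (K : set P) (mu : M -> P) n (c : 'I_n -> R) (g : 'I_n -> M) :
  is_submod K -> linear_mod K mu ->
  K (mu (\sum_j c j *: g j) - \sum_j c j *: mu (g j)).
Proof.
move=> sK muP; have [K0 KD KZ] := sK.
elim/big_rec2: _ => [|j y y' _ IH]; first by rewrite subr0; exact: (linear_mod0 sK muP).
have := KD _ _ (muP (c j) (g j) y') IH.
have aux (A B D Y : P) : A - (B + D) + (D - Y) = A - (B + Y).
  by rewrite opprD !addrA addrNK -addrA -opprD.
by rewrite aux.
Qed.

(** Finitely many elements of a projective module [P] lie in a finite free
    piece of it: [P] is a summand of the free module on the set [P]. *)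
Lemma projective_dual_basis (P : lmodType R) k (y : 'I_k -> P) :
    projective_module P ->
  exists r (q : 'I_r -> P) (c : 'I_r -> {linear P -> R^o}),
    forall l, y l = \sum_i c i (y l) *: q i.
Proof.
move=> projP.
pose pi : {additive {freeg P / R} -> P} := HB.pack (fglift (id : P -> P))
  (GRing.isAdditive.Build _ _ (fglift (id : P -> P)) (lift_is_additive _)).
have piU c x : pi << c *g x >> = c *: x by exact: liftU.
have piE D : pi D = \sum_(x <- dom D) coeff x D *: x.
  rewrite -{1}[D]freeg_sumE raddf_sum; apply: eq_bigr => x _; exact: piU.
have pi_lin : linear pi.
  move=> a D1 D2; rewrite raddfD; congr (_ + _).
  rewrite [in RHS]piE scaler_sumr [a *: D1]/(fgscale a D1) raddf_sum.
  by apply: eq_bigr => x _; rewrite scalerA; exact: piU.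
have [pi' pi'E] := lin_ex pi_lin.
have id_lin : linear (id : P -> P) by [].
have [|h hP] := projP _ _ pi' (lin_of id_lin).
  by move=> x; exists << 1 *g x >>; rewrite pi'E piU scale1r.
pose s := undup (flatten [seq dom (h (y l)) | l : 'I_k]).
have c_lin x : linear (fun z : P => coeff x (h z) : R^o).
  by move=> a z t; rewrite linearP coeffD coeffZ.
exists (size s), (fun i => tnth (in_tuple s) i).
exists (fun i => lin_of (c_lin (tnth (in_tuple s) i))) => l.
have {1}-> : y l = pi (h (y l)) by rewrite -pi'E hP.
rewrite -(big_tuple _ _ (in_tuple s) xpredT (fun x => coeff x (h (y l)) *: x)) /=.
rewrite [LHS]piE [RHS](bigID [pred x | x \in dom (h (y l))]) /= -!(big_filter s).
rewrite [X in _ = _ + X]big_seq [X in _ = _ + X]big1 ?addr0 => [|x].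
  apply: perm_big; apply: uniq_perm; rewrite ?uniq_dom ?filter_uniq ?undup_uniq //.
  move=> x; rewrite mem_filter /= mem_undup andb_idr // => xD.
  by apply/flatten_mapP; exists l; rewrite ?mem_enum.
by rewrite mem_filter => /andP[xD _]; rewrite coeff_outdom ?scale0r.
Qed.
End LinearAlgebra.

(** * Noetherian rings *)

Section Noetherian.
Variable R : comNzRingType.
Hypothesis noethR : noetherian R.
Implicit Types (M L : lmodType R) (I J : set R).

(** Otherwise a choice of strictly larger ideals gives an increasing sequence,
    and the finitely many generators of its union lie in one term. *)
Lemma noetherian_maximal (P : set R -> Prop) I :
    is_ideal I -> P I ->
  exists J, [/\ is_ideal J, P J, I `<=` J &
    forall K, is_ideal K -> P K -> J `<=` K -> K = J].
Proof.
move=> idI PI; apply: contrapT => nomax.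
pose good J := [/\ is_ideal J, P J & I `<=` J].
have step (x : {J | good J}) : exists y : {J | good J},
    sval x `<=` sval y /\ sval y <> sval x.
  case: x => J [idJ PJ IJ] /=; apply: contrapT => nstep; apply: nomax.
  exists J; split=> // K idK PK JK; apply: contrapT => KJ; apply: nstep.
  by exists (exist _ K (And3 idK PK (subset_trans IJ JK))).
have [next nextP] := choice step.
have good0 : good I by split.
pose c n := sval (iter n next (exist _ I good0)).
have idc n : is_ideal (c n) by rewrite /c; case: (iter _ _ _) => J [].
have cS n : c n `<=` c n.+1 by rewrite /c /=; case: (nextP (iter n next (exist _ I good0))).
have cle i j : (i <= j)%N -> c i `<=` c j.
  by move=> /subnKC <-; elim: (j - i)%N => [|k IH]; rewrite ?addn0 // addnS => x /IH /cS.
pose U : set R := [set x | exists n, c n x].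
have idU : is_ideal U.
  split=> [|x y [i xi] [j yj]|a x [i xi]].
  - by exists 0%N; case: (idc 0%N).
  - exists (maxn i j); case: (idc (maxn i j)) => _ D _; apply: D.
      by apply: cle xi; exact: leq_maxl.
    by apply: cle yj; exact: leq_maxr.
  - by exists i; case: (idc i) => _ _ Z; exact: Z.
have [n [g gU]] := noethR idU.
have gin (i : 'I_n) : exists k, c k (g i).
  suff : U (g i) by [].
  rewrite gU /=; exists (fun j => (j == i)%:R); rewrite (bigD1 i) //= eqxx mul1r.
  by rewrite big1 ?addr0 // => j /negPf ->; rewrite mul0r.
have [k kP] := choice gin.
pose K := \max_i k i.
have UK : U `<=` c K.
  move=> x; rewrite gU /= => -[a ->]; case: (idc K) => Z D S.
  apply: (big_ind (c K)) => // i _; apply: S; apply: cle (kP i); exact: leq_bigmax.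
have [_] := nextP (iter K next (exist _ I good0)); apply.
rewrite -/(c K); apply/seteqP; split; last exact: (cS K).
by move=> x xK; apply: UK; exists K.+1.
Qed.

Lemma noetherian_ind (P : set R -> Prop) :
    (forall I, is_ideal I ->
      (forall J, is_ideal J -> I `<=` J -> J <> I -> P J) -> P I) ->
  forall I, is_ideal I -> P I.
Proof.
move=> step I idI; apply: contrapT => nPI.
have [J [idJ nPJ _ maxJ]] := noetherian_maximal (P := fun K => ~ P K) idI nPI.
apply: nPJ; apply: step => // K idK JK KJ; apply: contrapT => nPK.
exact/KJ/maxJ.
Qed.

Definition fg_submod M (A : set M) : Prop :=
  exists k (a : {linear 'rV[R]_k -> M}), forall y, A y <-> exists x, y = a x.

Lemma fg_submod_ext M L (f : {linear M -> L}) (A : set M) :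
    is_submod A -> fg_submod [set f x | x in A] ->
    fg_submod [set x | A x /\ f x = 0] -> fg_submod A.
Proof.
move=> sA [k0 [a0 a0P]] [k1 [a1 a1P]].
have yex (j : 'I_k0) : exists z, A z /\ f z = a0 (delta_mx 0 j).
  by have [|z Az fz] := (a0P (a0 (delta_mx 0 j))).2; [exists (delta_mx 0 j)|exists z].
have [y yP] := choice yex.
have alin : linear (fun x : 'rV[R]_(k0 + k1) => comb y (lsubmx x) + a1 (rsubmx x)).
  by move=> c u v; rewrite !linearP addrACA -scalerDr.
exists (k0 + k1)%N, (lin_of alin) => z; split=> [Az|[x ->]].
- have /a0P [x0 x0P] : [set f x | x in A] (f z) by exists z.
  have fc : f (comb y x0) = f z.
    rewrite x0P (combE a0) lin_ofE linear_sum; apply: eq_bigr => j _.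
    by rewrite linearZ (yP j).2.
  have /a1P [x1 x1P] : A (z - comb y x0) /\ f (z - comb y x0) = 0.
    split; last by rewrite linearB fc subrr.
    apply: submodB => //; apply: submod_sum => // j _.
    by case: sA => _ _; apply; case: (yP j).
  by exists (row_mx x0 x1); rewrite lin_ofE row_mxKl row_mxKr -x1P addrC subrK.
- case: (sA) => _ D Z; rewrite lin_ofE; apply: D.
    by apply: submod_sum => // j _; apply: Z; case: (yP j).
  by have /a1P[] : exists x', a1 (rsubmx x) = a1 x' by exists (rsubmx x).
Qed.

Lemma fg_submod_ideal I : is_ideal I -> fg_submod (I : set R^o).
Proof.
move=> /noethR [n [g ->]]; exists n, (comb (g : 'I_n -> R^o)) => y; split.
  by move=> [c ->]; exists (\row_i c i); apply: eq_bigr => i _; rewrite mxE.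
by move=> [x ->]; exists (fun i => x 0 i).
Qed.

(** Induction on [n]: the first coordinates form an ideal, and the elements with
    first coordinate [0] a submodule in one dimension less. *)
Lemma fg_submod_rV n (A : set 'rV[R]_n) : is_submod A -> fg_submod A.
Proof.
elim: n A => [|n IH] A sA.
  exists 0%N, \0 => y; split=> [_|_]; first by exists 0; rewrite [y]thinmx0 [RHS]thinmx0.
  by rewrite [y]thinmx0; case: sA.
have f_lin : linear (fun x : 'rV[R]_(1 + n) => x 0 0 : R^o).
  by move=> a x y; rewrite !mxE.
have i_lin : linear (fun x : 'rV[R]_n => row_mx 0 x : 'rV[R]_(1 + n)).
  by move=> a x y; rewrite scale_row_mx add_row_mx scaler0 addr0.
apply: (@fg_submod_ext _ _ (lin_of f_lin)) => //.
  apply: fg_submod_ideal; case: sA => A0 AD AZ; split.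
  - by exists 0 => //; rewrite linear0.
  - by move=> _ _ [x Ax <-] [y Ay <-]; exists (x + y); [exact: AD|rewrite linearD].
  - by move=> a _ [x Ax <-]; exists (a *: x); [exact: AZ|rewrite linearZ].
have [k [a aP]] := IH _ (submod_preim (lin_of i_lin) sA).
exists k, (lin_of i_lin \o a) => y; split=> /=.
  move=> [Ay y0].
  have yE : y = row_mx 0 (rsubmx (y : 'rV_(1 + n))).
    rewrite -[y in LHS](@hsubmxK _ 1 1 n); congr row_mx.
    apply/rowP => i; rewrite ord1 !mxE -[RHS]y0; congr (y _ _); exact: val_inj.
  have /aP [x xP] : A (row_mx (0 : 'rV_1) (rsubmx (y : 'rV_(1 + n)))) by rewrite -yE.
  by exists x; rewrite -xP.
move=> [x ->]; split; first by have /aP : exists x', a x = a x' by exists x.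
by have -> : (0 : 'I_(1 + n)) = lshift n 0 :> 'I_(1 + n); [exact: val_inj|rewrite row_mxEl mxE].
Qed.

(** Nakayama's lemma, by induction on the number of elements: modulo [B] and the
    last element the others vanish, so the last one is [c] times itself modulo
    [B], for some [c] in [m]. *)
Lemma nakayama (m : set R) (V : lmodType R) (B : set V) r (z : 'I_r -> V) :
    is_ideal m -> (forall a, m a -> exists b, b * (1 - a) = 1) ->
    is_submod B ->
    (forall i, exists c : 'I_r -> R,
      (forall j, m (c j)) /\ B (z i - \sum_j c j *: z j)) ->
  forall i, B (z i).
Proof.
move=> [m0 mD mZ] unitm; elim: r B z => [|r IH] B z sB zP; first by case.
pose B' := add_im B (gen (z ord_max)).
have sB' : is_submod B' by exact: submod_add_im.
have zB' i : B' (z (widen_ord (leqnSn r) i)).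
  apply: (IH B' (fun i => z (widen_ord (leqnSn r) i))) => // {}i.
  have [c [mc Bc]] := zP (widen_ord (leqnSn r) i).
  exists (fun j => c (widen_ord (leqnSn r) j)); split=> //.
  move: Bc; rewrite big_ord_recr opprD addrA /= => Bc.
  by eexists; exists (c ord_max); split; [exact: Bc|rewrite lin_ofE subrK].
have zmax : exists c, m c /\ B (z ord_max - c *: z ord_max).
  have [c [mc Bc]] := zP ord_max; have [_ BD BZ] := sB.
  have bex (j : 'I_r) : exists b, B (z (widen_ord (leqnSn r) j) - b *: z ord_max).
    by have [n [b [Bn ->]]] := zB' j; exists b; rewrite lin_ofE addrK.
  have [b bP] := choice bex.
  exists (\sum_j c (widen_ord (leqnSn r) j) * b j + c ord_max); split.
    apply: (mD _ _ _ (mc _)); apply: (big_ind m m0 mD) => j _.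
    by rewrite mulrC; exact: mZ.
  have -> : z ord_max - (\sum_j c (widen_ord (leqnSn r) j) * b j + c ord_max) *: z ord_max =
     (z ord_max - \sum_j c j *: z j) +
     \sum_j c (widen_ord (leqnSn r) j) *: (z (widen_ord (leqnSn r) j) - b j *: z ord_max).
    rewrite big_ord_recr /= scalerDl scaler_suml.
    under [X in _ = _ + X]eq_bigr do rewrite scalerBr scalerA.
    have aux (x A T y : V) : x - (T + y) = x - (A + y) + (A - T).
      by rewrite [A + y]addrC [in RHS](opprD y A) !addrA subrK -[RHS]addrA -opprD [y + T]addrC.
    by rewrite sumrB; exact: aux.
  by apply: BD => //; apply: submod_sum => // j _; exact: BZ.
have Bmax : B (z ord_max).
  have [c [/unitm [b bc] Bc]] := zmax; have [_ _ BZ] := sB.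
  by rewrite -[z _]scale1r -bc -scalerA; apply: BZ; rewrite scalerBl scale1r.
move=> i; case: (unliftP ord_max i) => [j ->|-> //].
have -> : fintype.lift ord_max j = widen_ord (leqnSn r) j.
  by apply: val_inj; exact: lift_max.
have [n [b [Bn ->]]] := zB' j; have [_ BD BZ] := sB.
by apply: BD => //; exact: BZ.
Qed.

End Noetherian.

(** * Local rings and zero divisors *)

Section Local.
Variable R : comNzRingType.
Hypothesis noethR : noetherian R.
Implicit Types (I J P : set R).

Definition colon1 J (a : R) : set R := [set x | J (a * x)].

Lemma ideal_colon1 J a : is_ideal J -> is_ideal (colon1 J a).
Proof. by move=> idJ; exact: (@submod_preim R R^o R^o (scal _ a) J idJ). Qed.

Lemma sub_colon1 J a : is_ideal J -> J `<=` colon1 J a.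
Proof. by case=> _ _ JZ x Jx; exact: JZ. Qed.

(** The associated primes of [R/J] that are maximal among annihilators of
    nonzero elements, given by the elements that they annihilate. *)
Definition max_annihilated J (u : R) : Prop :=
  ~ J u /\ forall v, ~ J v -> colon1 J u `<=` colon1 J v -> colon1 J v = colon1 J u.

Lemma max_annihilated_prime J u :
  is_ideal J -> max_annihilated J u -> is_prime_ideal (colon1 J u).
Proof.
move=> idJ [Ju maxu]; split; first exact: ideal_colon1.
  by rewrite /colon1 /= mulr1.
move=> x y Jxy; have [Jy|Jy] := pselect (J (u * y)); first by right.
left; rewrite -(maxu (u * y) Jy); first by rewrite /colon1 /= -mulrA [y * x]mulrC.
by case: idJ => _ _ JZ z Jz; rewrite /colon1 /= mulrAC mulrC; exact: JZ.
Qed.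

Lemma max_annihilated_above J a : is_ideal J -> ~ J a ->
  exists2 u, max_annihilated J u & colon1 J a `<=` colon1 J u.
Proof.
move=> idJ Ja.
have [|_ [_ [u Ju ->] au maxu]] := noetherian_maximal noethR
  (P := fun I => exists2 u, ~ J u & I = colon1 J u) (ideal_colon1 a idJ).
  by exists a.
exists u => //; split=> // v Jv uv; apply: maxu => //; last by exists v.
exact: ideal_colon1.
Qed.

(** A product of elements, one from each of the ideals and outside [P]. *)
Lemma prime_avoid_inter P (us : seq R) (F : R -> set R) :
    is_prime_ideal P -> (forall u, is_ideal (F u)) ->
    (forall u, u \in us -> ~ F u `<=` P) ->
  exists2 w, ~ P w & forall u, u \in us -> F u w.
Proof.
move=> [[P0 PD PZ] P1 PM] idF; elim: us => [|v us IH] vus; first by exists 1.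
have [|w Pw wus] := IH; first by move=> u uus; apply: vus; rewrite inE uus orbT.
have /existsNP [z /not_implyP [Fz Pz]] := vus v (mem_head _ _).
exists (z * w); first by case/PM.
move=> u; rewrite inE => /predU1P[->|/wus Fw]; have [_ _ FZ] := idF u.
  by have [_ _ FvZ] := idF v; rewrite mulrC; exact: FvZ.
exact: FZ.
Qed.

(** Prime avoidance by induction on the list.  Two of these primes are equal or
    incomparable, by maximality; so either the new prime [P] is already avoided,
    or some [w] outside [P] lies in all the others, and adding a multiple of [w]
    to the element found so far moves it out of [P]. *)
Lemma prime_avoidance J (I : set R) (us : seq R) :
    is_ideal J -> is_ideal I -> (forall u, u \in us -> max_annihilated J u) ->
    (forall u, u \in us -> ~ I `<=` colon1 J u) ->
  exists2 z, I z & forall u, u \in us -> ~ J (u * z).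
Proof.
move=> idJ [I0 ID IZ]; elim: us => [|v us IH] maxus Ius; first by exists 0.
have [u uus|u uus|z Iz zus] := IH; first by apply: maxus; rewrite inE uus orbT.
  by apply: Ius; rewrite inE uus orbT.
have maxv := maxus v (mem_head _ _); have primev := max_annihilated_prime idJ maxv.
have [Jvz|Jvz] := pselect (J (v * z)); last first.
  by exists z => // u; rewrite inE => /predU1P[-> //|]; exact: zus.
have [|w vw wus] := prime_avoid_inter (us := us) primev (fun u => ideal_colon1 u idJ).
  move=> u uus uv; have [_ maxu] : max_annihilated J u.
    by apply: maxus; rewrite inE uus orbT.
  have vu := maxu v maxv.1 uv.
  by apply: (zus u uus); have : colon1 J v z by []; rewrite vu.
have /existsNP [y /not_implyP [Iy vy]] := Ius v (mem_head _ _).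
have [[_ vD vZ] _ vM] := primev.
exists (z + w * y); first by apply: ID => //; exact: IZ.
have [_ JD JZ] := idJ.
move=> u; rewrite inE => /predU1P[->|uus] Juz.
  have : colon1 J v (w * y).
    have -> : w * y = (z + w * y) + (- 1) * z by rewrite mulN1r addrC addKr.
    by apply: vD => //; exact: vZ.
  by case/vM.
apply: (zus u uus); have -> : u * z = u * (z + w * y) + - y * (u * w).
  by rewrite mulrDr mulNr [y * _]mulrC mulrA addrK.
by apply: JD => //; apply: JZ; exact: (wus u uus).
Qed.

(** Let [K] be maximal among the ideals generated by [J] and finitely many
    elements with maximal annihilator.  Every such element lies in [K], so its
    annihilator contains the intersection of finitely many of the primes, hence
    is one of them.  All zero divisors are thus in a finite union of primes, and
    [prime_avoidance] applies. *)
Lemma zero_divisors_annihilated J I : is_ideal J -> is_ideal I ->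
    (forall z, I z -> exists2 a, ~ J a & J (z * a)) ->
  exists2 u, ~ J u & forall z, I z -> J (z * u).
Proof.
move=> idJ idI zdiv; apply: contrapT => nou.
pose isK K := exists2 us : seq R, (forall u, u \in us -> max_annihilated J u) &
  K = [set x | exists j (c : nat -> R), J j /\ x = j + \sum_(i < size us) c i * nth 0 us i].
have [J0 JD JZ] := idJ.
have [|K [idK [us maxus KE] JK maxK]] := noetherian_maximal noethR (P := isK) idJ.
  exists [::] => //; apply/seteqP; split=> [x Jx|_ [x [c [Jx ->]]]].
    by exists x, (fun=> 0); rewrite big_ord0 addr0.
  by rewrite big_ord0 addr0.
have usnoI u : u \in us -> ~ I `<=` colon1 J u.
  move=> /maxus [Ju _] Iu; apply: nou; exists u => // z Iz.
  by rewrite mulrC; exact: Iu.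
have [z Iz zus] := prime_avoidance idJ idI maxus usnoI.
have [a Ja Jza] := zdiv z Iz.
have [v maxv av] := max_annihilated_above idJ Ja.
have vz : colon1 J v z by apply: av; rewrite /colon1 /= mulrC.
have primev := max_annihilated_prime idJ maxv.
have [w vw wus] : exists2 w, ~ colon1 J v w & forall u, u \in us -> colon1 J u w.
  apply: prime_avoid_inter => // [u|u uus uv]; first exact: ideal_colon1.
  have [_ maxu] := maxus _ uus.
  by apply: (zus u uus); have := vz; rewrite (maxu v maxv.1 uv).
have [_ KD KZ] := idK.
have usK i : (i < size us)%N -> K (nth 0 us i).
  move=> ius; rewrite KE; exists 0, (fun j => (j == i)%:R); split=> //.
  rewrite add0r (bigD1 (Ordinal ius)) //= eqxx mul1r big1 ?addr0 // => j.
  by move=> /negPf ji; rewrite -[_ == i]/(j == Ordinal ius) ji mul0r.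
have Kv : K v.
  pose K' : set R := [set x | exists j (c : nat -> R),
    J j /\ x = j + \sum_(i < size (v :: us)) c i * nth 0 (v :: us) i].
  have K'E x : K' x <-> exists k c, K k /\ x = k + c * v.
    rewrite KE; split=> [[j [c [Jj ->]]]|[_ [c [[j [b [Jj ->]]] ->]]]].
      exists (j + \sum_(i < size us) c i.+1 * nth 0 us i), (c 0%N); split.
        by exists j, (fun i => c i.+1).
      by rewrite big_ord_recl /= addrCA addrC.
    exists j, (fun i => if i is i'.+1 then b i' else c); split=> //.
    by rewrite big_ord_recl /= addrCA addrC.
  have idK' : is_ideal K'.
    have -> : K' = add_im (K : set R^o) (gen (v : R^o)).
      apply/seteqP; split=> x; rewrite /add_im => /=.
        by move=> /K'E [k [c [? ->]]]; exists k, c.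
      by move=> [k [c [? ->]]]; apply/K'E; exists k, c.
    exact: (@submod_add_im R R^o R^o).
  rewrite -(maxK K' idK') => [||x Kx].
  - apply/K'E; exists 0, 1; rewrite add0r mul1r; split=> //; by apply: JK.
  - exists (v :: us) => // u; rewrite inE => /predU1P[-> //|]; exact: maxus.
  - by apply/K'E; exists x, 0; rewrite mul0r addr0.
apply: vw; move: Kv; rewrite KE => -[j [c [Jj vE]]].
rewrite /colon1 /= {1}vE mulrDl mulr_suml; apply: (JD).
  by rewrite mulrC; exact: JZ.
apply: (big_ind J J0 JD) => i _; rewrite -mulrA; apply: JZ.
by apply: wus; exact: mem_nth.
Qed.

Variable m : set R.
Hypothesis locR : local_ring m.

Lemma ideal_max : is_ideal m.
Proof. by case: locR => -[]. Qed.

Lemma max_proper : ~ m 1.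
Proof. by case: locR => -[]. Qed.

Lemma proper_sub_max I : is_ideal I -> ~ I 1 -> I `<=` m.
Proof.
move=> idI I1.
have [J [idJ J1 IJ maxJ]] := noetherian_maximal noethR (P := fun K => ~ K 1) idI I1.
have <- // : J = m by apply: locR.2; split.
Qed.

Lemma local_unit a : ~ m a -> exists b, b * a = 1.
Proof.
move=> ma; apply: contrapT => nb; apply: ma.
apply: (@proper_sub_max [set x | exists b, x = b * a]); last by exists 1; rewrite mul1r.
  split=> [|_ _ [b ->] [c ->]|b _ [c ->]]; first by exists 0; rewrite mul0r.
    by exists (b + c); rewrite mulrDl.
  by exists (b * c); rewrite mulrA.
by move=> [b b1]; apply: nb; exists b.
Qed.

Lemma local_unitB a : m a -> exists b, b * (1 - a) = 1.
Proof.
move=> ma; apply: local_unit => ma1; apply: max_proper.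
by case: ideal_max => _ mD _; rewrite -[1](subrK a); exact: mD.
Qed.

End Local.

(** * Finite modules and regular sequences *)

Section FiniteModules.
Variable R : comNzRingType.
Hypothesis noethR : noetherian R.
Implicit Types M L E : lmodType R.

Lemma linear_eq_gen M E n (g : 'I_n -> M) (f h : {linear M -> E}) :
    (forall x, exists c : 'I_n -> R, x = \sum_(i < n) c i *: g i) ->
  (forall j, f (g j) = h (g j)) -> f =1 h.
Proof.
move=> gP fh x; have [c ->] := gP x; rewrite !linear_sum; apply: eq_bigr => j _.
by rewrite !linearZ fh.
Qed.

Lemma finite_module_rV n : finite_module ('rV[R]_n : lmodType R).
Proof.
exists n, (fun j => delta_mx 0 j) => x; exists (fun j => x 0 j).
exact: row_sum_delta.
Qed.

Lemma finite_module_regular : finite_module (R^o : lmodType R).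
Proof.
exists 1%N, (fun=> 1) => x; exists (fun=> x).
by rewrite big_ord1; exact: esym (mulr1 x).
Qed.

Lemma finite_cover M : finite_module M ->
  exists n (be : {linear 'rV[R]_n -> M}), surjective_map be.
Proof.
move=> [n [g gP]]; exists n, (comb g) => x; have [c ->] := gP x.
by exists (\row_j c j); apply: eq_bigr => j _; rewrite mxE.
Qed.

Lemma finite_presentation M (N : set M) : finite_module M -> is_submod N ->
  exists n (be : {linear 'rV[R]_n -> M}) k (al : {linear 'rV[R]_k -> 'rV[R]_n}),
    surjective_map be /\ forall y, N (be y) <-> exists x, y = al x.
Proof.
move=> /finite_cover [n [be sbe]] sN.
have [k [al alP]] := fg_submod_rV noethR (submod_preim be sN).
by exists n, be, k, al.
Qed.

(** A map is determined by its values at [n] generators, which embeds the dual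
    in [R^n]. *)
Lemma finite_dual M (N : set M) : finite_module M -> is_submod N ->
  exists r (f : 'I_r -> {linear M -> R^o}), (forall k, kills N (f k)) /\
    forall h : {linear M -> R^o}, kills N h ->
    exists c : 'I_r -> R, forall x, h x = \sum_k c k * f k x.
Proof.
move=> [n [g gP]] sN.
pose A : set 'rV[R]_n := [set b | exists2 h : {linear M -> R^o},
  kills N h & forall j, h (g j) = b 0 j].
have sA : is_submod A.
  split=> [|b b' [h kh hb] [h' kh' hb']|a b [h kh hb]].
  - by exists \0 => // j; rewrite mxE.
  - exists (h \+ h') => [x Nx|j] /=; first by rewrite kh ?kh' ?addr0.
    by rewrite mxE hb hb'.
  - exists (a \*: h) => [x Nx|j] /=; first by rewrite kh ?scaler0.
    by rewrite mxE hb.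
have [r [al alP]] := fg_submod_rV noethR sA.
have fex (k : 'I_r) : exists h : {linear M -> R^o},
    kills N h /\ forall j, h (g j) = al (delta_mx 0 k) 0 j.
  by have [|h kh hb] := (alP (al (delta_mx 0 k))).2; [exists (delta_mx 0 k)|exists h].
have [f fP] := choice fex; exists r, f; split=> [k|h kh]; first exact: (fP k).1.
have /alP [x xP] : A (\row_j h (g j)) by exists h => // j; rewrite mxE.
exists (fun k => x 0 k); apply: (linear_eq_gen (h := sum_lin (fun k => x 0 k) f) gP) => j.
have := congr1 (fun u : 'rV_n => u 0 j) xP; rewrite mxE => ->.
rewrite (combE al) summxE; apply: eq_bigr => k _.
by rewrite mxE (fP k).2.
Qed.

(** The submodule [N + (x_1, ..., x_t) M], for [s] the sequence of the [x_i]. *)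
Definition mod_seq M (N : set M) (s : seq R) : set M :=
  foldl (fun N x => add_im N (scal M x)) N s.

Fixpoint regular_seq M (N : set M) (s : seq R) : Prop :=
  if s is x :: s' then
    (forall y, N (x *: y) -> N y) /\ regular_seq (add_im N (scal M x)) s'
  else True.

Lemma submod_mod_seq M (N : set M) s : is_submod N -> is_submod (mod_seq N s).
Proof. by elim: s N => //= x s IH N sN; apply: IH; exact: submod_add_im. Qed.

Lemma regular_seq_cat M (N : set M) s s' :
  regular_seq N (s ++ s') <-> regular_seq N s /\ regular_seq (mod_seq N s) s'.
Proof.
elim: s N => [|x s IH] N /=; first by split=> [|[]].
by split=> [[? /IH[? ?]]|[[? ?] ?]]; split=> //; apply/IH.
Qed.

Lemma mod_seq_scale M I (N : set M) s a x :
    (forall b y, I b -> N (b *: y)) ->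
  mod_seq (I : set R^o) s a -> mod_seq N s (a *: x).
Proof.
elim: s I N a x => [|y s IH] I N a x IN /=; first exact: IN.
apply: IH => _ z [b [c [Ib ->]]]; exists (b *: z), (c *: z); split; first exact: IN.
by rewrite scalerDl; congr (_ + _); rewrite [RHS]scalerA.
Qed.

Lemma mod_seq_linear M L (f : {linear M -> L}) (N : set M) (K : set L) s x :
  (forall y, N y -> K (f y)) -> mod_seq N s x -> mod_seq K s (f x).
Proof.
elim: s N K x => [|y s IH] N K x NK /=; first exact: NK.
apply: IH => _ [b [c [Nb ->]]]; exists (f b), (f c); split; first exact: NK.
by rewrite linearD linearZ.
Qed.

(** Multiplication by [a] gives an exact sequence
    0 -> M/A -> M/N -> M/B -> 0; it stays exact modulo the first element of the
    sequence, because this element is regular on the last term. *)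
Lemma regular_seq_extension M (A N B : set M) a s :
    is_submod N -> (forall y, A y <-> N (a *: y)) ->
    (forall y, B y <-> add_im N (scal M a) y) ->
  regular_seq A s -> regular_seq B s -> regular_seq N s.
Proof.
elim: s A N B => //= x s IH A N B sN AP BP [Ax As] [Bx Bs].
have [N0 ND NZ] := sN.
have Ns y : N y -> B y by move=> Ny; apply/BP; exact: sub_add_im.
split=> [y Nxy|].
  have /BP [n [z [Nn yE]]] : B y by apply: Bx; exact: Ns.
  rewrite yE; apply: (ND) => //; apply/AP/Ax/AP.
  have -> : a *: (x *: z) = x *: y - x *: n.
    by rewrite yE scalerDr addrAC subrr add0r /= !scalerA mulrC.
  by apply: submodB => //; exact: NZ.
apply: (IH (add_im A (scal M x)) _ (add_im B (scal M x))) => //.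
- exact: submod_add_im.
- move=> y; split=> [[b [z [/AP Nab ->]]]|[n [w [Nn ayE]]]].
    exists (a *: b), (a *: z); split=> //.
    by rewrite scalerDr /= !scalerA mulrC.
  have /BP [n' [z [Nn' wE]]] : B w.
    apply/Bx/BP; exists (- n), y; split; first exact: submodN.
    by rewrite /= ayE addKr.
  exists (y - x *: z), z; split; last by rewrite /= subrK.
  apply/AP; have -> : a *: (y - x *: z) = n + x *: n'.
    rewrite scalerBr ayE wE /= scalerDr !addrA !scalerA [x * a]mulrC.
    by rewrite addrK.
  by apply: (ND) => //; exact: NZ.
- move=> y; split=> [[b [w [/BP [n [z [Nn ->]]] ->]]]|[_ [z [[n [w [Nn ->]]] ->]]]].
    exists (n + x *: w), z; split; last by rewrite addrAC.
    by exists n, w.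
  exists (n + a *: z), w; split; last by rewrite addrAC.
  by apply/BP; exists n, z.
Qed.

(** The power [x ^+ k.+2] is built from [x] and [x ^+ k.+1] by the extension
    0 -> M/(N + x^(k+1) M) -> M/(N + x^(k+2) M) -> M/(N + x M) -> 0. *)
Lemma regular_seq_pow1 M (N : set M) x s k :
    is_submod N -> (forall y, N (x *: y) -> N y) ->
    regular_seq (add_im N (scal M x)) s ->
  regular_seq (add_im N (scal M (x ^+ k.+1))) s.
Proof.
move=> sN regx regs; elim: k => [|k IH]; first by rewrite expr1.
have [N0 ND NZ] := sN.
apply: (regular_seq_extension (a := x)) IH regs; first exact: submod_add_im.
- move=> y; split=> [[n [z [Nn ->]]]|[n [z [Nn xyE]]]].
    exists (x *: n), z; split; first exact: NZ.
    by rewrite scalerDr /= scalerA -exprS.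
  exists (y - x ^+ k.+1 *: z), z; split; last by rewrite /= subrK.
  by apply: regx; rewrite scalerBr xyE /= scalerA -exprS addrK.
- move=> y; split=> [[n [z [Nn ->]]]|[_ [z [[n [w [Nn ->]]] ->]]]].
    by exists n, z; split=> //; exact: sub_add_im.
  exists n, (x ^+ k.+1 *: w + z); split=> //.
  by rewrite /= scalerDr scalerA -exprS addrA.
Qed.

Lemma regular_seq_pow M (N : set M) s q : (0 < q)%N ->
  is_submod N -> regular_seq N s -> regular_seq N [seq x ^+ q | x <- s].
Proof.
case: q => // k _; elim: s N => //= x s IH N sN [regx regs]; split.
  by elim: k.+1 => [|l IHl] y; rewrite ?scale1r // exprSr -scalerA => /IHl /regx.
by apply: IH; [exact: submod_add_im|exact: regular_seq_pow1].
Qed.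

End FiniteModules.

Section LocalRegularSequences.
Variables (R : comNzRingType) (m : set R).
Hypotheses (noethR : noetherian R) (locR : local_ring m).

Lemma mod_seq_sub_max s : (forall x, x \in s -> m x) -> mod_seq [set 0 : R^o] s `<=` m.
Proof.
have [m0 mD mZ] := ideal_max locR; move=> ms.
have : [set 0 : R^o] `<=` m by move=> _ ->.
elim: s ms [set 0 : R^o] => //= x l IH ml N Nm; apply: IH => [y yl|_ [y [b [Ny ->]]]].
  by apply: ml; rewrite inE yl orbT.
apply: mD; first exact: Nm.
by rewrite -[scal _ _ _]/(x * b) mulrC; apply: mZ; apply: ml; exact: mem_head.
Qed.

(** By the chain condition some ideal generated by a regular sequence is
    maximal; then all of [m] consists of zero divisors modulo this ideal. *)
Lemma maximal_regular_seq : exists (s : seq R) (u : R), [/\ forall x, x \in s -> m x,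
  regular_seq [set 0 : R^o] s, ~ mod_seq [set 0 : R^o] s u &
  forall z, m z -> mod_seq [set 0 : R^o] s (z * u)].
Proof.
pose P I := exists s, [/\ forall x, x \in s -> m x, regular_seq [set 0 : R^o] s &
  I = mod_seq [set 0 : R^o] s].
have [|J [idJ [s [ms regs JE]] _ maxJ]] := noetherian_maximal noethR (P := P) (submod0 R^o).
  by exists [::].
have [|u Ju muJ] := zero_divisors_annihilated noethR idJ (ideal_max locR).
  move=> z mz; apply: contrapT => nzd.
  have regz y : J (z * y) -> J y.
    by move=> Jzy; apply: contrapT => Jy; apply: nzd; exists y.
  have [J1|J1] := pselect (J 1).
    by apply: (max_proper locR); apply: (mod_seq_sub_max ms); rewrite -JE.
  apply: J1; apply: (regz); rewrite mulr1.
  have idJz : is_ideal (add_im (J : set R^o) (scal R^o z)) by exact: (@submod_add_im R R^o R^o).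
  rewrite -(maxJ _ idJz) => [||y Jy]; last exact: (@sub_add_im R R^o R^o).
    by have := @im_add_im R R^o R^o J (scal R^o z) 1 idJ; rewrite -[scal _ _ _]/(z * 1) mulr1.
  exists (rcons s z); split=> [y||].
  - by rewrite mem_rcons inE => /predU1P[->|/ms].
  - rewrite -cats1; apply/regular_seq_cat; split=> //=; rewrite -JE; split=> //; exact: regz.
  - by rewrite /mod_seq foldl_rcons -/(mod_seq _ _) -JE.
by exists s, u; rewrite -JE.
Qed.

End LocalRegularSequences.

(** * Cohomology of a complex of injective modules *)

(** Injectivity in module terms: a map from [L] that kills the preimage of [N]
    is a map from a submodule of [M/N], and extends to [M/N]. *)
Lemma extend_mod (R : comNzRingType) (L M E : lmodType R) (al : {linear L -> M})
    (N : set M) (f : {linear L -> E}) :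
    injective_module E -> is_submod N -> (forall x, N (al x) -> f x = 0) ->
  exists g : {linear M -> E}, (forall x, N x -> g x = 0) /\ forall x, g (al x) = f x.
Proof.
move=> injE sN Nf; have [N0 ND NZ] := sN.
pose G y e := exists x, N (y - al x) /\ e = f x.
have [||y [x [Nyx ->]]|g gG] := injective_extension (M := M) (G := G) injE.
- by exists 0; rewrite !linear0 addr0.
- move=> a y e y' e' [x [Nyx ->]] [x' [Nyx' ->]]; exists (a *: x + x'); split.
    rewrite linearP opprD addrACA -scalerBr; apply: (ND) => //; exact: NZ.
  by rewrite linearP.
- by apply: Nf; rewrite -[al x]opprK; apply: submodN => //; rewrite -sub0r.
exists g; split=> x.
  by move=> Nx; apply: gG; exists 0; rewrite !linear0 addr0.
by apply: gG; exists x; rewrite subrr.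
Qed.

Section Complex.
Variables (R : comNzRingType) (C : nat -> lmodType R).
Variable d : forall i, {linear C i -> C i.+1}.
Hypothesis injC : forall i, injective_module (C i).
Hypothesis dd : forall i x, d i.+1 (d i x) = 0.
Implicit Types M L E : lmodType R.

Definition cocycle M (N : set M) i (f : M -> C i) : Prop :=
  kills N f /\ forall x, d i (f x) = 0.

(** [H^i(Hom(M/N, C)) = 0], where [C i.+1] has degree [i].  Maps from [M/N] are
    maps from [M] that kill [N]. *)
Definition Ext_vanish M (N : set M) i : Prop :=
  forall f : {linear M -> C i.+1}, cocycle N f ->
  exists2 g : {linear M -> C i}, kills N g & forall x, f x = d i (g x).

(** Generation of [H^i(Hom(M/N, C))] by [r] elements; the case [r = 0] is
    vanishing, so both pass through the long exact sequence together. *)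
Definition Ext_gen r M (N : set M) i : Prop :=
  exists2 z : 'I_r -> {linear M -> C i.+1}, (forall k, cocycle N (z k)) &
  forall f : {linear M -> C i.+1}, cocycle N f ->
  exists (c : 'I_r -> R) (g : {linear M -> C i}),
    kills N g /\ forall x, f x = \sum_k c k *: z k x + d i (g x).

Lemma Ext_gen0 M (N : set M) i : Ext_gen 0 N i <-> Ext_vanish N i.
Proof.
split=> [[z _ zP] f cf|v].
  have [c [g [kg fg]]] := zP f cf; exists g => // x.
  by rewrite fg big_ord0 add0r.
exists (fun=> \0) => [[]//|f cf]; have [g kg fg] := v f cf.
by exists (fun=> 0), g; split=> // x; rewrite big_ord0 add0r.
Qed.

(* Pieces of the long exact sequence of the short exact sequence
   0 -> L/N' -> M/N -> M/(N + al L) -> 0. *)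
Section ShortExact.
Variables (L M : lmodType R) (al : {linear L -> M}) (N : set M) (N' : set L).
Hypotheses (sN : is_submod N) (N'P : forall x, N' x <-> N (al x)).

Lemma cocycle_extends i (f : {linear L -> C i}) :
    Ext_vanish (add_im N al) i -> cocycle N' f ->
  exists2 F : {linear M -> C i}, cocycle N F & forall x, F (al x) = f x.
Proof.
move=> v [kf df].
have [|f1 [kf1 f1E]] := extend_mod (al := al) (f := f) (@injC i) sN.
  by move=> x /N'P; exact: kf.
have [|w kw dw] := v (d i \o f1).
  split=> [_ [n [x [Nn ->]]]|x] /=; last exact: dd.
  by rewrite !linearD kf1 // f1E df !linear0 addr0.
exists (f1 \- w) => /=.
  split=> x /=; first by move=> Nx; rewrite kf1 // kw ?subrr //; exact: sub_add_im.
  by rewrite linearB -dw subrr.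
by move=> x; rewrite f1E kw ?subr0 //; exact: im_add_im.
Qed.

Lemma Ext_vanish_sub i :
  Ext_vanish N i -> Ext_vanish (add_im N al) i.+1 -> Ext_vanish N' i.
Proof.
move=> vN v f cf; have [F cF FE] := cocycle_extends v cf.
have [g kg dg] := vN F cF; exists (g \o al) => [x /N'P|x] /=; first exact: kg.
by rewrite -FE dg.
Qed.

Lemma Ext_vanish_mid i :
  Ext_vanish N' i -> Ext_vanish (add_im N al) i -> Ext_vanish N i.
Proof.
move=> v' v f [kf df].
have [|h kh dh] := v' (f \o al) _.
  by split=> x /=; [move=> /N'P; exact: kf|].
have [|h1 [kh1 h1E]] := extend_mod (al := al) (f := h) (@injC i) sN.
  by move=> x /N'P; exact: kh.
have [|g kg dg] := v (f \- (d i \o h1)).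
  split=> [_ [n [x [Nn ->]]]|x] /=; last by rewrite linearB df dd subrr.
  rewrite !linearD /= kf // kh1 // linear0 h1E -dh /=.
  by rewrite oppr0 !add0r subrr.
exists (g \+ h1) => x /=; first by move=> Nx; rewrite kg ?kh1 ?addr0 //; exact: sub_add_im.
by rewrite linearD -dg /= subrK.
Qed.

(** The connecting map is onto: a cocycle on the quotient is [d g] with [g] on
    [M/N], and [g] restricts to a cocycle on [L/N']. *)
Lemma Ext_gen_quot r i :
  Ext_gen r N' i -> Ext_vanish N i.+1 -> Ext_gen r (add_im N al) i.+1.
Proof.
move=> [z cz zP] v.
have zex k : exists z' : {linear M -> C i.+1},
    kills N z' /\ forall x, z' (al x) = z k x.
  apply: extend_mod => // x /N'P; exact: (cz k).1.
have [z' z'P] := choice zex.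
exists (fun k => d i.+1 \o z' k) => [k|f [kf df]].
  split=> [_ [n [x [Nn ->]]]|x] /=; last exact: dd.
  by rewrite !linearD (z'P k).1 // (z'P k).2 (cz k).2 linear0 addr0.
have [|g kg dg] := v f.
  by split=> // x Nx; apply: kf; exact: sub_add_im.
have [|c [h [kh gh]]] := zP (g \o al).
  split=> x /=; first by move=> /N'P; exact: kg.
  by rewrite -dg kf //; exact: im_add_im.
have [|h1 [kh1 h1E]] := extend_mod (al := al) (f := h) (@injC i) sN.
  by move=> x /N'P; exact: kh.
exists c, (g \- (sum_lin c z' \+ (d i \o h1))); split=> [_ [n [x [Nn ->]]]|x].
  rewrite linearD [X in X + _]/= kg // kh1 // linear0 addr0.
  rewrite big1 ?subr0 ?add0r => [|k _]; last by rewrite (z'P k).1 // scaler0.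
  rewrite /= h1E; have /= -> := gh x; rewrite [X in _ - (X + _)](eq_bigr (fun k => c k *: z k x)).
    by rewrite subrr.
  by move=> k _; rewrite (z'P k).2.
rewrite /= linearB linearD dd addr0 -dg linear_sum addrC -addrA.
rewrite (eq_bigr (fun k => c k *: d i.+1 (z' k x))) ?addNr ?addr0 // => k _.
by rewrite linearZ.
Qed.

Lemma Ext_vanish_quot i :
  Ext_vanish N' i -> Ext_vanish N i.+1 -> Ext_vanish (add_im N al) i.+1.
Proof. by move=> /Ext_gen0 g v; apply/Ext_gen0; exact: Ext_gen_quot. Qed.

End ShortExact.

Lemma Ext_vanishT M i : Ext_vanish [set: M] i.
Proof.
move=> f [kf _]; exists \0 => // x; by rewrite kf //= linear0.
Qed.

Lemma Ext_vanish_free n i :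
    (forall x, d i.+1 x = 0 -> exists y, x = d i y) ->
  Ext_vanish [set 0 : 'rV[R]_n] i.
Proof.
move=> ex f [_ df].
have wex (j : 'I_n) : exists y, f (delta_mx 0 j) = d i y by exact: ex.
have [w wP] := choice wex.
exists (comb w) => [x ->|x]; first exact: linear0.
rewrite combE linear_sum; apply: eq_bigr => j _.
by rewrite linearZ wP.
Qed.

Lemma Ext_gen_surjection r L M (be : {linear L -> M}) (N : set M) i :
    surjective_map be -> is_submod N ->
  Ext_gen r [set x | N (be x)] i -> Ext_gen r N i.
Proof.
move=> sbe sN [z cz zP].
have fac E (v : {linear L -> E}) : kills [set x | N (be x)] v ->
    exists w : {linear M -> E}, forall x, w (be x) = v x.
  move=> kv; apply: factor_surjection => // x bx.
  by apply: kv => /=; rewrite bx; case: sN.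
have zex k : exists z' : {linear M -> C i.+1}, forall x, z' (be x) = z k x.
  by apply: fac; case: (cz k).
have [z' z'P] := choice zex.
exists z' => [k|f [kf df]].
  split=> x; have [y <-] := sbe x; rewrite z'P; last exact: (cz k).2.
  exact: (cz k).1.
have [|c [g [kg fg]]] := zP (f \o be).
  by split=> x /=; [exact: kf|exact: df].
have [g' g'P] := fac _ g kg.
exists c, g'; split=> x; have [y <-] := sbe x.
  by move=> Ny; rewrite g'P kg.
rewrite g'P -[f _]/((f \o be) y) fg; congr (_ + _); apply: eq_bigr => k _.
by rewrite z'P.
Qed.

End Complex.

(** * Cohomology over a Gorenstein local ring *)

(* [C i.+1] is the term of degree [i] of an injective resolution of [R], of
   length at most [n0], and [eta] is the image of [1] in degree [0].  The term
   [C 0] is zero, so that degree [0] needs no separate treatment. *)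
Section GorensteinComplex.
Variables (R : comNzRingType) (m : set R) (C : nat -> lmodType R).
Variable d : forall i, {linear C i -> C i.+1}.
Hypothesis noethR : noetherian R.
Hypothesis locR : local_ring m.
Hypothesis injC : forall i, injective_module (C i).
Hypothesis dd : forall i x, d i.+1 (d i x) = 0.
Hypothesis C0 : forall x : C 0%N, x = 0.
Variable eta : C 1%N.
Hypothesis deta : d 1%N eta = 0.
Hypothesis eta_gen : forall x : C 1%N, d 1%N x = 0 -> exists a, x = a *: eta.
Hypothesis eta_free : forall a, a *: eta = 0 -> a = 0.
Hypothesis exC : forall i (x : C i.+2), d i.+2 x = 0 -> exists y, x = d i.+1 y.
Variable n0 : nat.
Hypothesis boundC : forall i (x : C i), (n0 < i)%N -> x = 0.
Implicit Types M L E P : lmodType R.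
Local Notation vanish := (Ext_vanish d).

Lemma cocycle_degree0 M (f : {linear M -> C 1%N}) : (forall x, d 1%N (f x) = 0) ->
  exists h : {linear M -> R^o}, forall x, f x = h x *: eta.
Proof.
move=> df.
have hex x : exists a, f x = a *: eta by exact: eta_gen.
have [h hP] := choice hex.
have uniq_eta a b : a *: eta = b *: eta -> a = b.
  move=> ab; apply/eqP; rewrite -subr_eq0; apply/eqP/eta_free.
  by rewrite scalerBl ab subrr.
have hlin : linear (h : M -> R^o).
  move=> a x y; apply: uniq_eta.
  by rewrite -hP linearP !hP scalerDl scalerA.
by exists (lin_of hlin).
Qed.

Lemma cocycle_of_degree0 M (N : set M) (h : {linear M -> R^o}) :
  kills N h -> cocycle d N (gen eta \o h).
Proof.
move=> kh; split=> x /=; first by move=> Nx; rewrite kh // scale0r.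
by rewrite linearZ /= deta scaler0.
Qed.

(** Dimension shifting along finite free covers leads to degree [0], where
    cocycles are maps to [R]. *)
Lemma Ext_fg i M (N : set M) : finite_module M -> is_submod N ->
  exists r, Ext_gen d r N i.
Proof.
elim: i M N => [|i IH] M N fM sN.
  have [r [f [kf fP]]] := finite_dual noethR fM sN.
  exists r, (fun k => gen eta \o f k) => [k|f' [kf' df']].
    exact: cocycle_of_degree0.
  have [h hP] := cocycle_degree0 df'.
  have [|c cP] := fP h.
    by move=> x Nx; apply: eta_free; rewrite -hP kf'.
  exists c, \0; split=> // x; rewrite linear0 addr0 hP cP scaler_suml.
  by apply: eq_bigr => k _; rewrite -scalerA.
have [n [be [k [al [sbe alP]]]]] := finite_presentation noethR fM sN.
have sK : is_submod [set x | al x = 0].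
  exact: (submod_preim al (submod0 _)).
have [r rP] := IH _ _ (finite_module_rV R k) sK.
exists r; apply: (Ext_gen_surjection sbe) => //.
have -> : [set x | N (be x)] = add_im [set 0] al.
  apply/seteqP; split=> y.
    by move=> /alP [x ->]; exact/im_add_im/submod0.
  by move=> [_ [x [-> ->]]]; apply/alP; exists x; rewrite add0r.
apply: (Ext_gen_quot injC dd (submod0 _) _ rP) => //.
by apply: Ext_vanish_free => x; exact: exC.
Qed.

(** The long exact sequence of multiplication by [x] on [M/N] makes [x] act
    onto on [H^i(M/N)], which is finitely generated. *)
Lemma Ext_vanish_nakayama M (N : set M) x i :
    finite_module M -> is_submod N -> m x -> (forall y, N (x *: y) -> N y) ->
  vanish (add_im N (scal M x)) i.+1 -> vanish N i.
Proof.
move=> fM sN mx regx v; have [r [z cz zP]] := Ext_fg i fM sN.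
(* B consists of the combinations of the generators that are coboundaries. *)
pose B : set 'rV[R]_r := [set c | exists2 g : {linear M -> C i},
  kills N g & forall y, \sum_k c 0 k *: z k y = d i (g y)].
have sB : is_submod B.
  split=> [|b b' [g kg gb] [g' kg' gb']|a b [g kg gb]].
  - exists \0 => // y; rewrite linear0 big1 // => k _.
    by rewrite mxE scale0r.
  - exists (g \+ g') => [y Ny|y] /=; first by rewrite kg ?kg' ?addr0.
    rewrite linearD -gb -gb' -big_split; apply: eq_bigr => k _.
    by rewrite mxE scalerDl.
  - exists (a \*: g) => [y Ny|y] /=; first by rewrite kg ?scaler0.
    rewrite linearZ /= -gb scaler_sumr; apply: eq_bigr => k _.
    by rewrite mxE scalerA.
have Bz k : B (delta_mx 0 k).
  apply: (nakayama (ideal_max locR) (local_unitB noethR locR) sB) => {}k.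
  have N'P y : N y <-> N (scal M x y).
    by split; [case: sN => _ _; apply|exact: regx].
  have [F cF FE] := cocycle_extends injC dd sN N'P v (cz k).
  have [c [g [kg Fg]]] := zP F cF.
  exists (fun j => x * c j); split.
    by move=> j; rewrite mulrC; case: (ideal_max locR) => _ _; exact.
  exists (x \*: g) => [y Ny|y] /=; first by rewrite kg ?scaler0.
  have -> : \sum_l (delta_mx 0 k - \sum_j (x * c j) *: delta_mx 0 j : 'rV_r) 0 l *: z l y
      = z k y - \sum_j (x * c j) *: z j y.
    rewrite -[LHS]/(comb (fun l => z l y) _) linearB comb_delta; congr (_ - _).
    by rewrite linear_sum; apply: eq_bigr => j _; rewrite linearZ comb_delta.
  rewrite -FE /= linearZ /= Fg scalerDr [RHS]linearZ /= scaler_sumr.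
  rewrite [X in X - _]addrC -addrA; under [X in _ + (X - _)]eq_bigr do rewrite scalerA.
  by rewrite subrr addr0.
move=> f cf; have [c [g [kg fg]]] := zP f cf.
have /= [g' kg' g'P] : B (\row_k c k).
  rewrite (row_sum_delta (\row_k c k)); apply: submod_sum => // k _.
  by case: sB => _ _; apply.
exists (g' \+ g) => [y Ny|y] /=; first by rewrite kg' ?kg ?addr0.
rewrite linearD fg -g'P; congr (_ + _); apply: eq_bigr => k _.
by rewrite mxE.
Qed.

(** Dividing by a regular element raises the top degree by one. *)
Lemma Ext_vanish_regular M (N : set M) s j :
    is_submod N -> regular_seq N s -> (forall i, (j < i)%N -> vanish N i) ->
  forall i, (j + size s < i)%N -> vanish (mod_seq N s) i.
Proof.
elim: s N j => [|x s IH] N j sN; first by move=> _ v i; rewrite addn0; exact: v.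
move=> [regx regs] v i /=; rewrite addnS -addSn => ji.
apply: (IH _ j.+1) ji => //; first exact: submod_add_im.
move=> {}i; case: i => // i ji; apply: (Ext_vanish_quot injC dd (N' := N)) => //.
- by move=> y; split; [case: sN => _ _; apply|exact: regx].
- exact: v.
- by apply: v; exact: leqW.
Qed.

(** Conversely the top degree drops by one for each regular element undone. *)
Lemma Ext_vanish_descend M (N : set M) s t :
    finite_module M -> is_submod N -> regular_seq N s -> (forall x, x \in s -> m x) ->
    (forall i, (t < i)%N -> vanish (mod_seq N s) i) ->
  forall i, (t < i + size s)%N -> vanish N i.
Proof.
move=> fM; elim: s N => [|x s IH] N sN; first by move=> _ _ v i; rewrite addn0; exact: v.
move=> [regx regs] ms v i /=; rewrite addnS -addSn => ti.
have mx : m x by apply: ms; exact: mem_head.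
apply: (Ext_vanish_nakayama fM sN mx regx); apply: IH ti => //.
  exact: submod_add_im.
by move=> y ys; apply: ms; rewrite inE ys orbT.
Qed.

Lemma Ext_vanish_R i : (0 < i)%N -> vanish [set 0 : R^o] i.
Proof.
case: i => // i _ f [_ df].
have [w wP] := exC (df 1); exists (gen w) => [x ->|x]; first by rewrite linear0.
by rewrite /= linearZ -wP -linearZ; congr (f _); rewrite /= [RHS]mulr1.
Qed.

(** Maps from [R/J] are elements killed by [J]. *)
Definition killed E (J : set R) (e : E) : Prop := forall a, J a -> a *: e = 0.

(** [H^j(R/J)] is a free [R/J]-module on the class of [e0]. *)
Definition Ext_free1 (J : set R) j : Prop := exists e0 : C j.+1,
  [/\ killed J e0, d j.+1 e0 = 0,
      forall e, killed J e -> d j.+1 e = 0 ->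
        exists a w, killed J w /\ e = a *: e0 + d j w &
      forall a w, killed J w -> a *: e0 = d j w -> J a].

Lemma Ext_vanish_killed J i (e : C i.+1) : vanish (J : set R^o) i ->
  killed J e -> d i.+1 e = 0 -> exists2 w, killed J w & e = d i w.
Proof.
move=> v ke de; have [|g kg eg] := v (gen e).
  by split=> x /=; [exact: ke|rewrite linearZ /= de scaler0].
exists (g 1); last by rewrite -eg /= scale1r.
move=> a Ja; rewrite -linearZ /= -[RHS](kg _ Ja); congr (g _); exact: mulr1.
Qed.

Lemma killed_divisible (J : set R) x i (e : C i) : is_ideal J ->
    (forall y, J (x * y) -> J y) -> killed J e ->
  exists2 e', killed J e' & e = x *: e'.
Proof.
move=> idJ regx ke.
have [|g [kg gE]] := extend_mod (M := R^o) (al := scal R^o x) (N := J) (f := gen e)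
    (@injC i) idJ.
  by move=> y /regx; exact: ke.
exists (g 1) => [a Ja|]; rewrite -linearZ /=.
  by rewrite -[RHS](kg _ Ja); congr (g _); exact: mulr1.
by rewrite -[LHS]scale1r -[LHS]gE.
Qed.

(** The generator for [J + xR] is the connecting image of that for [J]: divide
    [e0] by [x] in the injective module, and apply [d]. *)
Lemma Ext_free1_step (J : set R) x j : is_ideal J ->
    (forall y, J (x * y) -> J y) -> vanish (J : set R^o) j.+1 ->
  Ext_free1 J j -> Ext_free1 (add_im (J : set R^o) (scal R^o x)) j.+1.
Proof.
move=> idJ regx v [e0 [ke0 de0 e0_gen e0_free]]; have [J0 JD JZ] := idJ.
have killJx E (w : E) : killed J w -> x *: w = 0 ->
    killed (add_im (J : set R^o) (scal R^o x)) w.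
  move=> kw xw _ [a [b [Ja ->]]]; rewrite scalerDl kw // add0r.
  by rewrite -[scal _ _ _]/(x * b) mulrC -scalerA xw scaler0.
have Jxkill E (w : E) : killed (add_im (J : set R^o) (scal R^o x)) w ->
    killed J w /\ x *: w = 0.
  move=> kw; split=> [a Ja|]; first by apply: kw; exact: (@sub_add_im R R^o R^o).
  apply: kw; have := @im_add_im R R^o R^o J (scal R^o x) 1 idJ.
  by rewrite -[scal _ _ _]/(x * 1) mulr1.
have [e ke e0E] := killed_divisible idJ regx ke0.
exists (d j.+1 e); split; last 2 first.
- move=> z /Jxkill [kz xz] dz.
  have [w kw zw] := Ext_vanish_killed v kz dz.
  have [||a [y [ky xwE]]] := e0_gen (x *: w).
  + by move=> b Jb; rewrite scalerA mulrC -scalerA kw // scaler0.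
  + by rewrite linearZ -zw.
  have [y' ky' yE] := killed_divisible idJ regx ky.
  exists a, (w - (a *: e + d j y')); split; last first.
    by rewrite linearB linearD linearZ dd addr0 -zw addrC subrK.
  apply: killJx => [b Jb|].
    rewrite scalerBr scalerDr kw // scalerA mulrC -scalerA ke // scaler0 !add0r.
    by rewrite -linearZ ky' // linear0 oppr0.
  rewrite scalerBr scalerDr xwE e0E yE linearZ /= !scalerA mulrC.
  by rewrite linearZ /= subrr.
- move=> a w /Jxkill [kw xw] aw.
  have [||b [y [ky yE]]] := e0_gen (a *: e - w).
  + by move=> c Jc; rewrite scalerBr kw // subr0 scalerA mulrC -scalerA ke // scaler0.
  + by rewrite linearB linearZ -aw subrr.
  have Jab : J (a - x * b).
    apply: (e0_free _ (x *: y)); first by move=> c Jc; rewrite scalerA mulrC -scalerA ky ?scaler0.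
    have := congr1 (fun z => x *: z) yE; rewrite scalerBr scalerDr xw subr0.
    rewrite !scalerA [x * a]mulrC -[(a * x) *: e]scalerA -e0E => E.
    by rewrite scalerBl E addrAC subrr add0r linearZ.
  by exists (a - x * b), b; split=> //; rewrite -[scal _ _ _]/(x * b) subrK.
- apply: killJx => [b Jb|]; first by rewrite -linearZ ke // linear0.
  by rewrite -linearZ -e0E.
- exact: dd.
Qed.

Lemma Ext_free1_mod_seq s : regular_seq [set 0 : R^o] s ->
  Ext_free1 (mod_seq [set 0 : R^o] s) (size s).
Proof.
suff H : forall j (J : set R), is_ideal J -> (forall i, (j < i)%N -> vanish (J : set R^o) i) ->
    Ext_free1 J j -> regular_seq (J : set R^o) s ->
    Ext_free1 (mod_seq (J : set R^o) s) (j + size s).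
  apply: (H 0%N); first exact: (submod0 R^o).
    exact: Ext_vanish_R.
  exists eta; split=> [_ ->||e _ de|a w _]; first exact: scale0r.
  - exact: deta.
  - have [a ->] := eta_gen de; exists a, 0; split; last by rewrite linear0 addr0.
    by move=> b _; rewrite scaler0.
  - by rewrite (C0 w) linear0 => /eta_free.
elim: s => [|x s IH] j J idJ v f1 /=; first by rewrite addn0.
move=> [regx regs]; rewrite addnS -addSn; apply: IH => //.
- exact: (@submod_add_im R R^o R^o).
- case=> // i ji; apply: (@Ext_vanish_quot _ _ d injC dd R^o R^o (scal R^o x) J J) => //.
  + by move=> y; split; [case: idJ => _ _; apply|exact: regx].
  + exact: v.
  + by apply: v; exact: leqW.
- by apply: Ext_free1_step => //; exact: v.
Qed.

(** [Ext^1_R(M, K) = 0] for every finite [M] with [Ext^i_R(M, R) = 0] for all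
    [i > 0]: here [M] is the cokernel of [al], and a map [v] to [K] from the
    module of relations extends to the free module.  The modules [M] in question
    are closed under syzygies, which allows dimension shifting in [K]. *)
Definition Ext1_vanish P (K : set P) : Prop :=
  forall n (A : set 'rV[R]_n) k (al : {linear 'rV[R]_k -> 'rV[R]_n}),
    is_submod A -> (forall i, (0 < i)%N -> vanish A i) ->
    (forall y, A y <-> exists x, y = al x) ->
  forall v : {linear 'rV[R]_k -> P}, (forall x, K (v x)) ->
    (forall x, al x = 0 -> v x = 0) ->
  exists w : {linear 'rV[R]_n -> P}, (forall x, K (w x)) /\ forall x, w (al x) = v x.

Lemma add_im0E M L (f : {linear L -> M}) (A : set M) :
  (forall y, A y <-> exists x, y = f x) -> add_im [set 0] f = A.
Proof.
move=> AP; apply/seteqP; split=> [_ [_ [x [-> ->]]]|y /AP [x ->]].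
  by apply/AP; exists x; rewrite add0r.
exact/im_add_im/submod0.
Qed.

Lemma Ext1_vanish_ring : Ext1_vanish [set: R^o].
Proof.
move=> n A k al sA vA AP v _ kv.
have Nal (x : 'rV_k) : [set y | al y = 0] x <-> [set 0] (al x) by [].
have vA1 : vanish (add_im [set 0] al) 1 by rewrite (add_im0E AP); exact: vA.
have [F [_ dF] FE] := cocycle_extends injC dd (submod0 _) Nal vA1
  (cocycle_of_degree0 (kv : kills [set y | al y = 0] v)).
have [w wP] := cocycle_degree0 dF; exists w; split=> // x.
apply/eqP; rewrite -subr_eq0; apply/eqP/eta_free.
by rewrite scalerBl -wP FE subrr.
Qed.

(** Finitely many elements of a projective module have coordinates, and each
    coordinate is a map to [R]. *)
Lemma Ext1_vanish_projective P : projective_module P -> Ext1_vanish [set: P].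
Proof.
move=> projP n A k al sA vA AP v _ kv.
have [r [q [c qc]]] := projective_dual_basis (fun l : 'I_k => v (delta_mx 0 l)) projP.
have wex i : exists w : {linear 'rV[R]_n -> R^o}, forall x, w (al x) = c i (v x).
  have [||w [_ wP]] := Ext1_vanish_ring sA vA AP (v := c i \o v) => //.
    by move=> x /= /kv ->; rewrite linear0.
  by exists w.
have [w wP] := choice wex.
pose W : {linear 'rV[R]_n -> P} := lin_of (@sum_linear R _ P r (fun=> 1) (fun i => gen (q i) \o w i)).
exists W; split=> // x; rewrite /= (eq_bigr (fun i => c i (v x) *: q i)).
  have lin_c : linear (fun y : P => \sum_i c i y *: q i).
    move=> a y z; rewrite scaler_sumr -big_split; apply: eq_bigr => i _.
    by rewrite linearP scalerDl scalerA.
  rewrite -[LHS]/(lin_of lin_c (v x)) (combE v) linear_sum; apply: eq_bigr => l _.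
  by rewrite linearZ /= -qc.
by move=> i _; rewrite scale1r wP.
Qed.

(** A map from the relations of [M] to the image of [K] lifts to [K] up to an
    error on the second syzygy with values in the kernel.  The error extends,
    because the first syzygy is again acyclic. *)
Lemma Ext1_vanish_image P (P' : lmodType R) (de : {linear P -> P'}) (K : set P) :
    is_submod K -> Ext1_vanish K -> Ext1_vanish [set x | K x /\ de x = 0] ->
  Ext1_vanish [set de x | x in K].
Proof.
move=> sK EK Eker n A k al sA vA AP v vK kv.
have uex (j : 'I_k) : exists y, K y /\ de y = v (delta_mx 0 j).
  by have [y Ky yE] := vK (delta_mx 0 j); exists y.
have [u uP] := choice uex.
have uK x : K (comb u x).
  by apply: submod_sum => // j _; case: sK => _ _; apply; exact: (uP j).1.
have deu x : de (comb u x) = v x.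
  rewrite (combE v) linear_sum; apply: eq_bigr => j _.
  by rewrite linearZ (uP j).2.
pose B : set 'rV[R]_k := [set x | al x = 0].
have sB : is_submod B by exact: (submod_preim al (submod0 _)).
have [l [be beP]] := fg_submod_rV noethR sB.
have vB i : (0 < i)%N -> vanish B i.
  move=> i0; apply: (Ext_vanish_sub injC dd (al := al) (submod0 _)) => //.
    by case: i i0 => // i _; apply: Ext_vanish_free => x; exact: exC.
  by rewrite (add_im0E AP); exact: vA.
have [||w' [w'K w'P]] := Eker _ _ _ be sB vB beP (comb u \o be).
- move=> x /=; split; first exact: uK.
  have : B (be x) by apply/beP; exists x.
  by rewrite -/(comb u (be x)) deu; exact: kv.
- by move=> x bx; rewrite -[LHS]/(comb u (be x)) bx linear0.
have [||w [wK wP]] := EK _ _ _ al sA vA AP (comb u \- w').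
- by move=> x; apply: submodB => //; case: (w'K x).
- move=> x /beP [y ->]; rewrite -[LHS]/(comb u (be y) - w' (be y)) w'P.
  by rewrite subrr.
exists (de \o w); split=> x /=; first by exists (w x).
rewrite wP -[X in de X]/(comb u x - w' x) linearB deu.
by case: (w'K x) => _ ->; rewrite subr0.
Qed.

Lemma Ext1_vanish0 P : Ext1_vanish [set 0 : P].
Proof.
move=> n A k al _ _ _ v v0 _; exists \0; split=> // x.
by rewrite [RHS]v0.
Qed.

Lemma Ext1_vanish_prod P (P' : lmodType R) (K : set P) (K' : set P') :
  Ext1_vanish K -> Ext1_vanish K' -> Ext1_vanish ([set x | K x.1 /\ K' x.2] : set (P * P')%type).
Proof.
move=> EK EK' n A k al sA vA AP v vK kv.
have fst_lin : linear (@fst P P') by move=> a [? ?] [? ?].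
have snd_lin : linear (@snd P P') by move=> a [? ?] [? ?].
have [||w [wK wP]] := EK _ _ _ al sA vA AP (lin_of fst_lin \o v).
- by move=> x; case: (vK x).
- by move=> x /kv /= ->.
have [||w' [wK' wP']] := EK' _ _ _ al sA vA AP (lin_of snd_lin \o v).
- by move=> x; case: (vK x).
- by move=> x /kv /= ->.
have wlin : linear (fun x => (w x, w' x)) by move=> a x y; rewrite !linearP.
exists (lin_of wlin); split=> x; first exact: (conj (wK x) (wK' x)).
by rewrite lin_ofE wP wP' /=; case: (v x).
Qed.

(* J + xR is the image of J x R, and the kernel is isomorphic to J. *)
Section AddRegular.
Variables (J : set R) (x : R).
Hypotheses (idJ : is_ideal J) (regx : forall y, J (x * y) -> J y).

Fact addx_linear : linear (fun c : R^o * R^o => c.1 + x * c.2 : R^o).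
Proof.
move=> a c c'; rewrite /= mulrDr addrACA scalerDr; congr (_ + (_ + _)).
by rewrite -[a *: c.2]/(a * c.2) mulrCA.
Qed.

Let dom : set (R^o * R^o)%type := [set c | J c.1 /\ [set: R^o] c.2].

Lemma addx_image : [set lin_of addx_linear c | c in dom] = add_im (J : set R^o) (scal R^o x).
Proof.
apply/seteqP; split=> [_ [[a b] [/= Ja _] <-]|_ [a [b [Ja ->]]]]; first by exists a, b.
by exists (a, b).
Qed.

Lemma submod_dom : is_submod dom.
Proof. by case: idJ => J0 JD JZ; split=> [|a b [? ?] [? ?]|a b [? ?]]; split=> //; [exact: JD|exact: JZ]. Qed.

Lemma Ext1_vanish_addx_ker : Ext1_vanish (J : set R^o) ->
  Ext1_vanish [set c | dom c /\ lin_of addx_linear c = 0].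
Proof.
move=> EJ.
have rel_lin : linear (fun b : R^o => (- (x * b), b) : R^o * R^o).
  move=> a b b'; apply: injective_projections => //=.
  by rewrite mulrDr opprD scalerN; congr (- _ - _); rewrite -[a *: b]/(a * b) mulrCA.
have -> : [set c | dom c /\ lin_of addx_linear c = 0] = [set lin_of rel_lin b | b in J].
  apply/seteqP; split=> [[a b] [[/= Ja _] ab]|_ [b Jb <-]].
    have aE : a = - (x * b) by apply/eqP; rewrite -addr_eq0; apply/eqP.
    exists b; last by rewrite aE.
    by apply: regx; rewrite -[x * b]opprK -aE; exact: (@submodN R R^o).
  split; last by rewrite /= addNr.
  split=> //=; apply: (@submodN R R^o) => //; rewrite mulrC.
  by rewrite mulrC; case: idJ => _ _; apply.
apply: (@Ext1_vanish_image R^o (R^o * R^o)%type (lin_of rel_lin) J idJ EJ).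
have -> : [set b | J b /\ lin_of rel_lin b = 0] = [set 0 : R^o].
  apply/seteqP; split=> [b [_ /= [_ //]]|_ ->].
  by split; [case: idJ|exact: linear0].
exact: Ext1_vanish0.
Qed.

Lemma Ext1_vanish_addx : Ext1_vanish (J : set R^o) ->
  Ext1_vanish (add_im (J : set R^o) (scal R^o x)).
Proof.
move=> EJ; rewrite -addx_image; apply: Ext1_vanish_image submod_dom _ _.
  exact: (Ext1_vanish_prod EJ Ext1_vanish_ring).
exact: Ext1_vanish_addx_ker.
Qed.
End AddRegular.

Lemma Ext1_vanish_mod_seq s : regular_seq [set 0 : R^o] s ->
  Ext1_vanish (mod_seq [set 0 : R^o] s).
Proof.
have: Ext1_vanish [set 0 : R^o] by exact: Ext1_vanish0.
have: is_submod [set 0 : R^o] by exact: submod0.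
elim: s [set 0 : R^o] => //= x s IH J idJ EJ [regx regs].
apply: IH => //; first exact: submod_add_im.
exact: Ext1_vanish_addx.
Qed.

(** Descending induction along the finite resolution: each syzygy is the image
    of a projective module, with the next syzygy as kernel. *)
Lemma Ext1_vanish_syzygy (P : nat -> lmodType R) n
    (de : forall i, {linear P i.+1 -> P i}) :
    (forall i, projective_module (P i)) -> (forall i, (n < i)%N -> zero_module (P i)) ->
    (forall i, exact_at (de i.+1) (de i)) ->
  forall i, Ext1_vanish [set y | exists x, de i x = y].
Proof.
move=> projP P0 exP i; have [k] := ubnP (n - i)%N.
elim: k i => // k IH i ik.
have [ni|ni] := leqP n i.
  have -> : [set y | exists x, de i x = y] = [set 0].
    apply/seteqP; split=> [_ [x <-]|_ ->]; last by exists 0; exact: linear0.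
    by rewrite (P0 i.+1 _ x) ?linear0.
  exact: Ext1_vanish0.
have -> : [set y | exists x, de i x = y] = [set de i x | x in setT].
  by apply/seteqP; split=> y [x]; [move=> <-; exists x|move=> _ <-; exists x].
apply: Ext1_vanish_image => //; first exact: Ext1_vanish_projective.
have -> : [set x | [set: P i.+1] x /\ de i x = 0] = [set y | exists x, de i.+1 x = y].
  by apply/seteqP; split=> y; [move=> [_ /exP]|move=> /exP].
by apply: IH; rewrite -ltnS; apply: leq_trans ik; rewrite ltnS subnS prednK ?subn_gt0.
Qed.

Section Acyclic.
Variable M : lmodType R.
Hypothesis fM : finite_module M.
Hypothesis vM : forall i, (0 < i)%N -> vanish [set 0 : M] i.

(** On a finite free cover of [M] the map lifts; on the relations the lift has
    values in [K], and there the vanishing of [Ext^1] corrects it. *)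
Lemma lift_linear_mod P (K : set P) (mu : M -> P) :
    is_submod K -> Ext1_vanish K -> linear_mod K mu ->
  exists f : {linear M -> P}, forall x, K (f x - mu x).
Proof.
move=> sK EK muP; have [K0 KD KZ] := sK.
have [n [be [k [al [sbe alP]]]]] := finite_presentation noethR fM (submod0 M).
pose u : {linear 'rV[R]_n -> P} := comb (fun j => mu (be (delta_mx 0 j))).
have uP b : K (u b - mu (be b)).
  rewrite -opprB (combE be); apply: submodN => //.
  exact: (linear_mod_sum (fun j => b 0 j) (fun j => be (delta_mx 0 j)) sK muP).
pose B : set 'rV[R]_n := [set b | be b = 0].
have sB : is_submod B by exact: (submod_preim be (submod0 _)).
have vB i : (0 < i)%N -> vanish B i.
  move=> i0; apply: (Ext_vanish_sub injC dd (al := be) (submod0 _)) => //.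
    exact: vM.
  have -> : add_im [set 0] be = setT.
    by apply/seteqP; split=> // y _; have [b <-] := sbe y; exact/im_add_im/submod0.
  exact: Ext_vanishT.
have [||w [wK wP]] := EK _ _ _ al sB vB alP (u \o al).
- move=> x; have bx : be (al x) = 0 by apply/alP; exists x.
  rewrite -[X in K X](subrK (mu (be (al x)))); apply: (KD); first exact: uP.
  by rewrite bx; exact: (linear_mod0 sK muP).
- by move=> x alx; rewrite -[LHS]/(u (al x)) alx linear0.
have [|f fP] := factor_surjection (v := u \- w) sbe.
  by move=> b /alP [x ->] /=; rewrite wP subrr.
exists f => x; have [b <-] := sbe x; rewrite fP /= addrAC.
by apply: submodB => //; exact: uP.
Qed.

Lemma lift_through P (P' : lmodType R) (de : {linear P -> P'}) (L : set P)
    (f : {linear M -> P'}) :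
    is_submod L -> Ext1_vanish [set x | L x /\ de x = 0] ->
    (forall x, exists2 y, L y & de y = f x) ->
  exists g : {linear M -> P}, (forall x, L (g x)) /\ forall x, de (g x) = f x.
Proof.
move=> sL Eker fL; have [L0 LD LZ] := sL.
have muex x : exists y, L y /\ de y = f x by have [y] := fL x; exists y.
have [mu muP] := choice muex.
have sK : is_submod [set x | L x /\ de x = 0].
  split=> [|x y [Lx dx] [Ly dy]|a x [Lx dx]]; split=> //; rewrite ?linear0 //.
  - exact: LD.
  - by rewrite linearD dx dy addr0.
  - exact: LZ.
  - by rewrite linearZ /= dx scaler0.
have [|g gP] := lift_linear_mod (mu := mu) sK Eker.
  move=> a x y; split.
    apply: submodB => //; first exact: (muP _).1.
    by apply: (LD); [apply: LZ|]; exact: (muP _).1.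
  by rewrite linearB linearD linearZ /= !(muP _).2 linearP subrr.
exists g; split=> x; have [Lg dg] := gP x.
  by rewrite -[g x](subrK (mu x)); apply: LD => //; exact: (muP _).1.
by apply/eqP; rewrite -(muP x).2 -subr_eq0 -linearB dg.
Qed.

(** Maps to [J + xR] lift to [J x R], which splits off one element of the
    sequence at a time. *)
Lemma hom_into_mod_seq s (f : {linear M -> R^o}) :
    regular_seq [set 0 : R^o] s -> (forall x, mod_seq [set 0 : R^o] s (f x)) ->
  exists g : 'I_(size s) -> {linear M -> R^o},
    forall x, f x = \sum_(i < size s) nth 0 s i * g i x.
Proof.
move=> regs fJ.
suff [f0 [g [f0J fg]]] : exists (f0 : {linear M -> R^o}) (g : 'I_(size s) -> {linear M -> R^o}),
    (forall x, [set 0 : R^o] (f0 x)) /\ forall x, f x = f0 x + \sum_(i < size s) nth 0 s i * g i x.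
  by exists g => x; rewrite fg f0J add0r.
have: Ext1_vanish [set 0 : R^o] by exact: Ext1_vanish0.
have: is_submod [set 0 : R^o] by exact: submod0.
elim: s [set 0 : R^o] f regs fJ => [|x s IH] J f /=.
  by move=> _ fJ _ _; exists f, (fun=> \0); split=> // y; rewrite big_ord0 addr0.
move=> [regx regs] fJ idJ EJ.
have sJx := submod_add_im (scal R^o x) idJ.
have [f1 [g [f1J fg]]] := IH _ f regs fJ sJx (Ext1_vanish_addx idJ regx EJ).
have [|c [cJ cE]] := lift_through (f := f1) (submod_dom idJ)
    (Ext1_vanish_addx_ker idJ regx EJ).
  move=> y; have [a [b [Ja ab]]] := f1J y.
  by exists (a, b); rewrite ?ab.
have fst_lin : linear (@fst R^o R^o) by move=> a [? ?] [? ?].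
have snd_lin : linear (@snd R^o R^o) by move=> a [? ?] [? ?].
exists (lin_of fst_lin \o c).
exists (fun i => oapp g (lin_of snd_lin \o c) (unlift ord0 i)); split=> y.
  by case: (cJ y).
rewrite fg -cE /= -addrA; congr (_ + _); rewrite big_ord_recl unlift_none /=.
by congr (_ + _); apply: eq_bigr => i _; rewrite liftK.
Qed.

(* B is the cyclic module R/ker pi. *)
Section FiniteProjectiveDimension.
Variables (B : lmodType R) (pi : {linear R^o -> B}).
Hypotheses (spi : surjective_map pi) (pdB : finite_projective_dimension B).

(** [f] lifts to the first term of the resolution, which maps to [R] over [B]. *)
Lemma finite_pd_lift (f : {linear M -> B}) :
  exists h : {linear M -> R^o}, forall x, pi (h x) = f x.
Proof.
have [n [P [de [eps [projP P0 seps ex0 exS]]]]] := pdB.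
have EK : Ext1_vanish [set x | [set: P 0%N] x /\ eps x = 0].
  have -> : [set x | [set: P 0%N] x /\ eps x = 0] = [set y | exists x, de 0%N x = y].
    by apply/seteqP; split=> y; [move=> [_ /ex0]|move=> /ex0].
  exact: (Ext1_vanish_syzygy projP P0 exS).
have [|g [_ gf]] := lift_through (f := f) (submodT _) EK.
  by move=> x; have [y yx] := seps (f x); exists y.
have [k kP] := projP 0%N _ _ pi eps spi.
by exists (k \o g) => x; rewrite /= kP gf.
Qed.

(** Comparison maps between [R] and the first term [P 0] of the resolution send
    [1] to [y0] and [y0] to [k y0], which is congruent to [1] modulo [ker pi].
    The map [f y0] lifts to [P 1], where a dual basis writes it as a combination;
    the image of [P 1] in [R] lies in [ker pi].  This treats [k y0 * f], and the
    factor [1 - k y0] of the remaining term is in [ker pi]. *)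
Lemma finite_pd_hom_ideal (f : {linear M -> R^o}) : (forall x, pi (f x) = 0) ->
  exists r (a : 'I_r -> R) (g : 'I_r -> {linear M -> R^o}),
    (forall i, pi (a i) = 0) /\ forall x, f x = \sum_i a i * g i x.
Proof.
move=> pif.
have [n [P [de [eps [projP P0 seps ex0 exS]]]]] := pdB.
have [k kP] := projP 0%N _ _ pi eps spi.
have [y0 y0E] := seps (pi 1).
have EK : Ext1_vanish [set x | [set: P 1%N] x /\ de 0%N x = 0].
  have -> : [set x | [set: P 1%N] x /\ de 0%N x = 0] = [set y | exists x, de 1%N x = y].
    by apply/seteqP; split=> y; [move=> [_ /exS]|move=> /exS].
  exact: (Ext1_vanish_syzygy projP P0 exS).
have [|g [_ gf]] := lift_through (f := gen y0 \o f) (submodT _) EK.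
  move=> x; have [|y yE] := (ex0 (f x *: y0)).1; last by exists y.
  by rewrite linearZ y0E -linearZ -[_ *: 1]/(f x * 1) mulr1.
have [l [w wP]] := fM.
have [r [q [c qc]]] := projective_dual_basis (fun j => g (w j)) (projP 1%N).
have gE x : g x = \sum_i c i (g x) *: q i.
  have lin_c : linear (fun y => \sum_i c i y *: q i).
    move=> a y z; rewrite scaler_sumr -big_split; apply: eq_bigr => i _.
    by rewrite linearP scalerDl scalerA.
  exact: (linear_eq_gen (f := g) (h := lin_of lin_c \o g) wP).
have kq i : pi (k (de 0%N (q i))) = 0 by rewrite kP; apply/ex0; exists (q i).
have k1 : pi (1 - k y0) = 0 by rewrite linearB kP y0E subrr.
exists r.+1, (fun i => oapp (fun j => k (de 0%N (q j))) (1 - k y0) (unlift ord0 i)).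
pose cg j : {linear M -> R^o} := c j \o g.
exists (fun i => oapp cg f (unlift ord0 i)); split=> [i|x].
  by case: (unlift ord0 i).
rewrite big_ord_recl unlift_none /=.
rewrite (eq_bigr (fun j => c j (g x) * k (de 0%N (q j)))) => [|j _]; last first.
  by rewrite liftK /= mulrC.
have <- : f x * k y0 = \sum_j c j (g x) * k (de 0%N (q j)).
  have := congr1 k (gf x); rewrite /= [RHS]linearZ => <-.
  rewrite {1}gE !linear_sum; apply: eq_bigr => j _.
  by rewrite !linearZ.
by rewrite mulrC -mulrDr subrK mulr1.
Qed.

End FiniteProjectiveDimension.

End Acyclic.

Section Depth.
Variable s : seq R.
Hypothesis ms : forall x, x \in s -> m x.
Hypothesis regs : regular_seq [set 0 : R^o] s.
Let J : set R := mod_seq [set 0 : R^o] s.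
Variable u : R.
Hypotheses (Ju : ~ J u) (muJ : forall z, m z -> J (z * u)).

Lemma ideal_J : is_ideal J.
Proof. exact: (@submod_mod_seq R R^o _ s (submod0 R^o)). Qed.

(** Descending induction on [i], from the length of the resolution.  When the
    cohomology of degree [i.+1] vanishes, that of degree [i] is right exact.  It
    vanishes on [R/J], hence on [R/m], which [u] embeds in [R/J].  Noetherian
    induction then covers all [I]: if [I] is not prime, [R/I] is an extension of
    smaller quotients; if it is a prime other than [m], some element of [m] is
    regular on [R/I] and Nakayama's lemma applies. *)
Lemma Ext_vanish_cyclic i (I : set R) : (size s < i)%N -> is_ideal I ->
  vanish (I : set R^o) i.
Proof.
suff /(_ n0.+1) : forall k i (I : set R), (n0 < i + k)%N -> (size s < i)%N ->
    is_ideal I -> vanish (I : set R^o) i.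
  by move=> H si; apply: H => //; rewrite addnS ltnS leq_addl.
elim=> [|k IHk] {}i {}I.
  rewrite addn0 => ni _ _ f cf; exists \0 => // x.
  by rewrite linear0; apply: boundC; exact: leqW.
rewrite addnS -addSn => nik si.
have IHi K : is_ideal K -> vanish (K : set R^o) i.+1.
  by apply: IHk => //; exact: leqW.
have vm : vanish (m : set R^o) i.
  have idJ := ideal_J.
  apply: (@Ext_vanish_sub _ _ d injC dd R^o R^o (scal R^o u) J) => //.
  - move=> x; split=> [mx|Jux]; first by have := muJ mx; rewrite mulrC.
    apply: contrapT => mx; have [b bx] := local_unit noethR locR mx.
    apply: Ju; have -> : u = b * (u * x) by rewrite mulrCA bx mulr1.
    by case: idJ => _ _; apply.
  - apply: (Ext_vanish_regular (j := 0)) => //; first exact: submod0.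
    exact: Ext_vanish_R.
  - by apply: IHi; exact: (@submod_add_im R R^o R^o).
move: I; apply: (noetherian_ind noethR (P := fun I => vanish (I : set R^o) i)) => I idI IHI.
have [I1|I1] := pselect (I 1).
  have -> : I = setT.
    by apply/seteqP; split=> // x _; rewrite -[x]mulr1; case: idI => _ _; apply.
  exact: Ext_vanishT.
have Im := proper_sub_max noethR locR idI I1.
have [Ipr|] := pselect (forall x y, I (x * y) -> I x \/ I y).
  have [Imeq|Imne] := pselect (m `<=` I).
    by have -> : I = m by apply/seteqP.
  have /existsNP [y /not_implyP [my Iy]] := Imne.
  apply: (@Ext_vanish_nakayama R^o I y) => //; first exact: finite_module_regular.
    by move=> x /Ipr [].
  by apply: IHi; exact: (@submod_add_im R R^o R^o).
move=> /existsNP [x /existsNP [y /not_implyP [Ixy /not_orP [Ix Iy]]]].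
have [I0 ID IZ] := idI.
apply: (@Ext_vanish_mid _ _ d injC dd R^o R^o (scal R^o x) I (colon1 I x)) => //.
  apply: IHI; [exact: ideal_colon1|exact: sub_colon1|].
  by move=> Ieq; apply: Iy; rewrite -Ieq.
apply: IHI; first exact: (@submod_add_im R R^o R^o).
  by move=> z Iz; exact: (@sub_add_im R R^o R^o).
move=> Ieq; apply: Ix; rewrite -Ieq -[X in add_im _ _ X](mulr1 x).
exact: (@im_add_im R R^o R^o I (scal R^o x) 1).
Qed.

(** Filtration of [M] by submodules with cyclic quotients. *)
Lemma Ext_vanish_finite M (N : set M) i : finite_module M -> is_submod N ->
  (size s < i)%N -> vanish N i.
Proof.
move=> [n [g gP]] sN si.
have {gP} : forall x, exists c : 'I_n -> R, N (x - \sum_(j < n) c j *: g j).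
  by move=> x; have [c ->] := gP x; exists c; rewrite subrr; case: sN.
elim: n N sN g => [|n IH] N sN g gP.
  have -> : N = setT.
    by apply/seteqP; split=> // x _; have [c] := gP x; rewrite big_ord0 subr0.
  exact: Ext_vanishT.
apply: (@Ext_vanish_mid _ _ d injC dd R^o M (gen (g ord_max)) N
          [set a | N (a *: g ord_max)]) => //.
  by apply: Ext_vanish_cyclic => //; exact: (submod_preim (gen (g ord_max)) sN).
apply: (IH _ _ (fun j => g (widen_ord (leqnSn n) j))); first exact: submod_add_im.
move=> x; have [c cP] := gP x; exists (fun j => c (widen_ord (leqnSn n) j)).
move: cP; rewrite big_ord_recr opprD addrA => cP.
by eexists; exists (c ord_max); split; [exact: cP|rewrite lin_ofE subrK].
Qed.

Lemma Ext_vanish_full_depth M (N : set M) s' i :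
    finite_module M -> is_submod N -> regular_seq N s' ->
    (forall x, x \in s' -> m x) -> size s' = size s ->
  (0 < i)%N -> vanish N i.
Proof.
move=> fM sN reg' ms' ss' i0; apply: (Ext_vanish_descend (t := size s) fM sN reg') => //.
  by move=> {i0}i si; apply: Ext_vanish_finite => //; exact: submod_mod_seq.
by rewrite ss' -[X in (X < _)%N]add0n ltn_add2r.
Qed.

(* All regular sequences of the length of s have the properties of s. *)
Section FullLength.
Variable s' : seq R.
Hypotheses (ms' : forall x, x \in s' -> m x) (size_s' : size s' = size s).
Hypothesis regs' : regular_seq [set 0 : R^o] s'.
Let J' : set R := mod_seq [set 0 : R^o] s'.

Let idJ' : is_ideal J'.
Proof. exact: (@submod_mod_seq R R^o _ s' (submod0 R^o)). Qed.

(** Otherwise [s'] extends to a longer regular sequence.  Its top cohomology is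
    free of rank one over a nonzero quotient, but it lies above the degree where
    all cohomology vanishes. *)
Lemma socle_exists : exists2 u', ~ J' u' & forall z, m z -> J' (z * u').
Proof.
apply: (zero_divisors_annihilated noethR idJ' (ideal_max locR)) => z mz.
apply: contrapT => nzd.
have regz y : J' (z * y) -> J' y.
  by move=> Jzy; apply: contrapT => Jy; apply: nzd; exists y.
have regs'z : regular_seq [set 0 : R^o] (rcons s' z).
  by rewrite -cats1; apply/regular_seq_cat.
have := Ext_free1_mod_seq regs'z.
rewrite /mod_seq size_rcons foldl_rcons -/(mod_seq _ _) -/J' => -[e0 [ke0 de0 _ free]].
have idJz : is_ideal (add_im (J' : set R^o) (scal R^o z)) by exact: (@submod_add_im R R^o R^o).
have [|w kw e0w] := Ext_vanish_killed _ ke0 de0.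
  by apply: Ext_vanish_cyclic => //; rewrite size_s'.
have [a [b [Ja ab]]] : add_im (J' : set R^o) (scal R^o z) (1 : R).
  by apply: (free 1 w kw); rewrite scale1r.
apply: (max_proper locR); rewrite ab -[scal _ _ _]/(z * b).
have [_ mD mZ] := ideal_max locR.
by apply: mD; [exact: (mod_seq_sub_max locR ms')|rewrite mulrC; exact: mZ].
Qed.

(** Self-injectivity of [R/J'], for a partial map with graph [G] from the finite
    [R/J']-module [M/J'M].  Composed with the generator of [H^t(R/J')] the map
    takes values in an injective module and extends.  The extension is a cocycle
    up to a class of degree [t+1] on a finite module, hence up to a coboundary;
    and cocycles killed by [J'] are multiples of the generator modulo
    coboundaries, which gives the values in [R/J']. *)
Lemma quotient_self_injective M (G : M -> R -> Prop) : finite_module M ->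
    (forall a x e y f, G x e -> G y f -> G (a *: x + y) (a * e + f)) ->
    (forall e, G 0 e -> J' e) -> (forall a x, J' a -> G (a *: x) 0) ->
  exists mu : M -> R, linear_mod (J' : set R^o) (mu : M -> R^o) /\
    forall x e, G x e -> J' (mu x - e).
Proof.
move=> fM GL GJ JG.
have J'0 : J' 0 by case: idJ'.
have G00 : G 0 0 by rewrite -(scale0r (0 : M)); exact: JG.
have [e0 [ke0 de0 e0_gen e0_free]] := Ext_free1_mod_seq regs'.
have [||x [e [Ge ->]]|f fG] := injective_extension (M := M)
    (G := fun x y => exists e, G x e /\ y = e *: e0) (@injC (size s').+1).
- by exists 0; rewrite scale0r.
- move=> a x _ y _ [e [Ge ->]] [e' [Ge' ->]]; exists (a * e + e').
  by split; [exact: GL|rewrite scalerDl scalerA].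
- by apply: ke0; exact: GJ.
pose A : set M := [set x | exists e, G x e].
have sA : is_submod A.
  split=> [|x y [e Ge] [e' Ge']|a x [e Ge]]; first by exists 0.
    by exists (1 * e + e'); have := GL 1 _ _ _ _ Ge Ge'; rewrite scale1r.
  by exists (a * e + 0); have := GL a _ _ _ _ Ge G00; rewrite addr0.
have vA : vanish A (size s').+1 by apply: Ext_vanish_finite => //; rewrite size_s'.
have [|g kg dg] := vA (d _ \o f).
  split=> x /=; last exact: dd.
  by move=> [e Ge]; rewrite (fG x (e *: e0)); [rewrite linearZ /= de0 scaler0|exists e].
have muex x : exists a, exists2 w, killed J' w & f x - g x = a *: e0 + d _ w.
  have [||a [w [kw E]]] := e0_gen (f x - g x); last by exists a, w.
    move=> a Ja; rewrite scalerBr -!linearZ /= (fG (a *: x) 0) ?kg ?subr0 //.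
      by exists 0; exact: JG.
    by exists 0; rewrite scale0r; split=> //; exact: JG.
  by rewrite linearB -dg subrr.
have [mu muP] := choice muex.
have mu_eq a w x : killed J' w -> f x - g x = a *: e0 + d _ w -> J' (mu x - a).
  move=> kw E; have [w' kw' E'] := muP x.
  apply: (e0_free _ (w - w')); first by move=> b Jb; rewrite scalerBr kw ?kw' ?subr0.
  rewrite scalerBl linearB -[mu x *: e0](addrK (d _ w')) -E' E.
  by rewrite -[X in X - _ = _]addrA [a *: e0 + _]addrC addrK.
exists mu; split=> [a x y|x e Ge].
  have [w kw E] := muP x; have [w' kw' E'] := muP y.
  apply: (mu_eq _ (a *: w + w')).
    by move=> b Jb; rewrite scalerDr kw' // addr0 scalerA mulrC -scalerA kw // scaler0.
  rewrite !linearP /= addrACA -[a *: f x + _]scalerDr E E' [in LHS]scalerDr scalerA scalerDl.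
  by rewrite -!addrA; congr (_ + _); rewrite addrCA.
apply: (mu_eq _ 0); first by move=> b _; rewrite scaler0.
by rewrite linear0 addr0 (kg x) ?subr0; [apply: fG; exists e|exists e].
Qed.

(** The map [u' -> z] is well defined on the simple submodule spanned by [u'];
    since [R/J'] is self-injective, it is multiplication by a ring element. *)
Lemma socle_cyclic (u' z : R) :
    ~ J' u' -> (forall a, m a -> J' (a * u')) -> (forall a, m a -> J' (a * z)) ->
  exists a, J' (z - a * u').
Proof.
move=> J'u' mu' mz; have [J'0 J'D J'Z] := idJ'.
pose G (x b : R) := exists c j : R, [/\ J' j, x = c * u' + j & J' (b - c * z)].
have [|b||nu [nulin nuG]] :=
    quotient_self_injective (M := R^o) (G := G) (finite_module_regular R).
- move=> a x b x' b' [c [j [Jj -> Jb]]] [c' [j' [Jj' -> Jb']]].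
  exists (a * c + c'), (a * j + j'); split.
  + by apply: (J'D) => //; exact: J'Z.
  + by rewrite -[a *: _]/(a * _); ring.
  + have -> : a * b + b' - (a * c + c') * z = a * (b - c * z) + (b' - c' * z) by ring.
    by apply: (J'D) => //; exact: J'Z.
- move=> [c [j [Jj E Jb]]].
  have mc : m c.
    apply: contrapT => mc; have [c' c'c] := local_unit noethR locR mc; apply: J'u'.
    have -> : u' = (- c') * j.
      rewrite -[u']mul1r -c'c -mulrA; have -> : c * u' = - j by apply/eqP; rewrite -addr_eq0 -E.
      by rewrite mulrN mulNr.
    exact: J'Z.
  by rewrite -[b](subrK (c * z)); apply: (J'D) => //; exact: mz.
- move=> a x Ja; exists 0, (a * x); split; [|by rewrite mul0r add0r|by rewrite mul0r subr0].
  by rewrite mulrC; exact: J'Z.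
have Jnuu : J' (nu u' - z).
  by apply: nuG; exists 1, 0; split; rewrite ?mul1r ?addr0 ?subrr.
exists (nu 1); have := nulin u' 1 0; rewrite addr0 -[u' *: 1]/(u' * 1) mulr1 => Jn.
have aux (A B D Z : R) : Z - B = (A - (B + D)) + (D + (-1) * (A - Z)) by ring.
rewrite [nu 1 * u']mulrC (aux (nu u') _ (nu 0)).
by apply: (J'D) => //; apply: (J'D); [exact: (@linear_mod0 R R^o R^o J' nu idJ' nulin)|exact: J'Z].
Qed.

End FullLength.

(** * The Frobenius pushforward as a module of full depth *)

(* A scalar a acts on S = F^e_* R as a ^+ q, so s on S is the sequence of the
   q-th powers on R, and J S is the ideal J' of these powers. *)
Section Frobenius.
Variables (p : nat) (chRp : p \in [pchar R]) (e : nat).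
Hypothesis fS : finite_module (Fstar chRp e : lmodType R).
Local Notation q := (p ^ e)%N.
Local Notation S := (Fstar chRp e).
Local Notation s' := [seq x ^+ q | x <- s].
Local Notation J' := (mod_seq [set 0 : R^o] s' : set R).
Implicit Types (f h : {linear S -> R^o}).

Let q_gt0 : (0 < q)%N.
Proof. by rewrite expn_gt0 prime_gt0 // (pcharf_prime chRp). Qed.

Let ms' x : x \in s' -> m x.
Proof.
move=> /mapP [y ys ->]; rewrite -(prednK q_gt0) exprSr.
by case: (ideal_max locR) => _ _; apply; exact: ms.
Qed.

Let regs' : regular_seq [set 0 : R^o] s'.
Proof. exact: (regular_seq_pow q_gt0 (submod0 R^o) regs). Qed.

Let size_s' : size s' = size s. Proof. exact: size_map. Qed.

Lemma mod_seq_Fstar (N : set R) l :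
  mod_seq (N : set S) l = mod_seq (N : set R^o) [seq x ^+ q | x <- l].
Proof. by elim: l N => //= x l IH N; rewrite -IH. Qed.

Lemma regular_seq_Fstar (N : set R) l :
  regular_seq (N : set R^o) [seq x ^+ q | x <- l] -> regular_seq (N : set S) l.
Proof. by elim: l N => //= x l IH N [regx /IH]. Qed.

Lemma Ext_vanish_Fstar i : (0 < i)%N -> vanish [set 0 : S] i.
Proof.
apply: (Ext_vanish_full_depth fS (submod0 _) (s' := s)) => //.
exact: (@regular_seq_Fstar [set 0]).
Qed.

Lemma mod_seq_frobenius_scale (a x : R) : J a -> J' (a ^+ q * x).
Proof.
rewrite -(mod_seq_Fstar [set 0]) => Ja.
apply: (@mod_seq_scale _ S [set 0] [set 0] s a x _ Ja) => b y /= ->.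
by rewrite scale0r.
Qed.

Lemma hom_mod_seq_frobenius h (x : R) : J' x -> J (h x).
Proof.
rewrite -(mod_seq_Fstar [set 0]); apply: mod_seq_linear => y ->.
exact: linear0.
Qed.

Let idJ' : is_ideal J'.
Proof. exact: (@submod_mod_seq R R^o _ s' (submod0 R^o)). Qed.

(** The partial map [z -> u] from [S/J'] to [R/J] is well defined, as [u] is
    killed by [m]; it extends by self-injectivity, and lifts to [R]. *)
Lemma Fstar_torsionless (z : R) : ~ J' z -> exists h, ~ J (h z).
Proof.
move=> J'z; have [J0 JD JZ] := ideal_J; have [J'0 J'D J'Z] := idJ'.
pose G (y : S) (b : R) := exists a j : R, [/\ J' j, y = a ^+ q * z + j & J (b - a * u)].
have mJ (a : R) : J' (a ^+ q * z) -> m a.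
  move=> Jaz; apply: contrapT => ma; have [b ba] := local_unit noethR locR ma.
  apply: J'z; have -> : z = b ^+ q * (a ^+ q * z) by rewrite mulrA -exprMn ba expr1n mul1r.
  exact: J'Z.
have [|b|a x Ja|mu [mulin muG]] := quotient_self_injective (s' := s) (erefl _) regs (G := G) fS.
- move=> a x b y c [a1 [j1 [Jj1 -> Jb]]] [a2 [j2 [Jj2 -> Jc]]].
  exists (a * a1 + a2), (a ^+ q * j1 + j2); split.
  + by apply: (J'D) => //; exact: J'Z.
  + rewrite -[RHS]/((a * a1 + a2) *: (z : S) + (a *: (j1 : S) + j2)).
    rewrite -[a1 ^+ q * z]/(a1 *: (z : S)) -[a2 ^+ q * z]/(a2 *: (z : S)).
    by rewrite scalerDl scalerDr scalerA addrACA.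
  + have -> : a * b + c - (a * a1 + a2) * u = a * (b - a1 * u) + (c - a2 * u).
      by rewrite mulrDl opprD addrACA mulrBr mulrA.
    by apply: (JD) => //; exact: JZ.
- move=> [a [j [Jj E Jb]]].
  have ma : m a.
    apply: mJ; have -> : a ^+ q * z = - j by apply/eqP; rewrite -addr_eq0 -E.
    exact: (@submodN R R^o).
  by rewrite -[b](subrK (a * u)); apply: (JD) => //; exact: muJ.
- exists 0, (a ^+ q * x); split; first exact: mod_seq_frobenius_scale.
    by rewrite expr0n (gtn_eqF q_gt0) mul0r add0r.
  by rewrite mul0r subr0.
have [f fmu] := lift_linear_mod fS Ext_vanish_Fstar (mu := mu : S -> R^o) ideal_J
  (Ext1_vanish_mod_seq regs) mulin.
exists f => Jfz; apply: Ju.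
have Jmz : J (mu z - u).
  apply: muG; exists 1, 0; split=> //; first by rewrite expr1n mul1r addr0.
  by rewrite mul1r subrr.
have -> : u = f z + (- 1) * ((f z - mu z) + (mu z - u)).
  by rewrite addrA subrK mulN1r opprB addrC subrK.
by apply: (JD) => //; apply: JZ; apply: (JD) => //; exact: fmu.
Qed.

Lemma hom_mul0 h (x : R) : h (0 * x : R) = 0.
Proof. by rewrite (mul0r x) linear0. Qed.

Lemma hom_mulD h (b c x : R) : h ((b + c) * x : R) = h (b * x : R) + h (c * x : R).
Proof. by rewrite (mulrDl b c x) linearD. Qed.

Lemma hom_mulZ h (a b x : R) : h (a ^+ q * b * x : R) = a * h (b * x : R).
Proof.
by rewrite -(mulrA (a ^+ q) b x) -[a ^+ q * (b * x)]/(a *: (b * x : S)) linearZ.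
Qed.

Fact premul_linear h (a : R) : linear (fun x : S => h (a * x : R)).
Proof.
move=> b x y; rewrite -linearP; congr (h _).
by rewrite -[b *: x]/(b ^+ q * x) mulrDr mulrCA.
Qed.
Definition premul h a : {linear S -> R^o} := lin_of (premul_linear h a).

(** Let [u'] span the socle of [S/J'], and let [f0] be nonzero on it modulo [J].
    If some [h] is not in [W = S f0 + m Hom(S, R)], then [h -> u] defines a
    linear map from [R h + W] to [R/J] that kills [W].  Elements of [Hom(S, R)]
    are vectors of values at generators of [S]; since [R/J] is self-injective, the
    map extends to all vectors, so it is evaluation at some [z] in [S].  As [W]
    contains [m Hom(S, R)], the element [z] is in the socle of [S/J'], so it is a unit
    multiple of [u'] modulo [J']; but [W] contains [S f0], which does not vanish
    there. *)
Lemma hom_Fstar_cyclic : exists f0 : {linear S -> R^o},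
  forall h, exists b : R, forall x : R, h x = f0 (b * x : R).
Proof.
have [J0 JD JZ] := ideal_J; have [J'0 J'D J'Z] := idJ'.
have [m0 mD mZ] := ideal_max locR.
have mq a : m a -> m (a ^+ q) by rewrite -(prednK q_gt0) exprSr => ma; exact: mZ.
have [u' J'u' mu'] := socle_exists ms' size_s' regs'.
have [f0 Jf0u'] := Fstar_torsionless J'u'.
have [r [g [_ gP]]] := finite_dual noethR fS (submod0 (S : lmodType R)).
have gP' h : exists c : 'I_r -> R, forall x : R, h x = \sum_k g k (c k * x : R).
  have [|c cP] := gP h; first by move=> x ->; exact: linear0.
  exists (fun k => c k ^+ q) => x; rewrite cP; apply: eq_bigr => k _.
  by rewrite -[c k ^+ q * x]/(c k *: (x : S)) linearZ.
(* W = S f0 + m Hom(S, R), with the elements of Hom(S, R) as plain functions. *)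
pose W (h : R -> R) := exists (b : R) (c : 'I_r -> R), (forall k, m (c k)) /\
  forall x : R, h x = f0 (b * x : R) + \sum_k g k (c k * x : R).
have W0 : W (fun=> 0).
  exists 0, (fun=> 0); split=> // x; rewrite hom_mul0 add0r big1 // => k _.
  exact: hom_mul0.
have WD (k k' : R -> R) : W k -> W k' -> W (fun x => k x + k' x).
  move=> [b [c [mc hE]]] [b' [c' [mc' h'E]]].
  exists (b + b'), (fun i => c i + c' i); split=> [i|x]; first exact: mD.
  rewrite hE h'E hom_mulD addrACA -big_split; congr (_ + _).
  by apply: eq_bigr => i _; rewrite hom_mulD.
have WZ a (k : R -> R) : W k -> W (fun x => a * k x).
  move=> [b [c [mc hE]]]; exists (a ^+ q * b), (fun i => a ^+ q * c i).
  split=> [i|x]; first exact: mZ.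
  rewrite hE mulrDr mulr_sumr hom_mulZ; congr (_ + _).
  by apply: eq_bigr => i _; rewrite hom_mulZ.
have Wm z (h : {linear S -> R^o}) : m z -> W (fun x => h (z * x : R)).
  move=> mz; have [c cP] := gP' h; exists 0, (fun k => c k * z); split=> [k|x].
    exact: mZ.
  rewrite hom_mul0 add0r cP; apply: eq_bigr => k _.
  by rewrite (mulrA (c k) z x).
(* By Nakayama's lemma for the coefficient vectors c of the combinations of the
   generators g that are multiples of f0, it is enough that W is everything. *)
suff hW (h : {linear S -> R^o}) : W h.
  pose B : set 'rV[R]_r := [set c | exists b : R, forall x : R,
    \sum_k g k (c 0 k * x : R) = f0 (b * x : R)].
  have sB : is_submod B.
    split=> [|c c' [b bP] [b' bP']|a c [b bP]].
    - exists 0 => x; rewrite hom_mul0 big1 // => k _.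
      by rewrite mxE hom_mul0.
    - exists (b + b') => x; rewrite hom_mulD -bP -bP' -big_split.
      by apply: eq_bigr => k _; rewrite mxE hom_mulD.
    - exists (b * a) => x; rewrite -(mulrA b a x) -bP; apply: eq_bigr => k _.
      by rewrite mxE (mulrA (c 0 k) a x) [c 0 k * a]mulrC.
  have Bd k : B (delta_mx 0 k).
    apply: (nakayama (ideal_max locR) (local_unitB noethR locR) sB) => {}k.
    have [b [c [mc gE]]] := hW (g k); exists c; split=> //; exists b => x.
    have cE : \sum_j c j *: delta_mx 0 j = \row_j c j :> 'rV_r.
      by rewrite [RHS]row_sum_delta; apply: eq_bigr => j _; rewrite mxE.
    apply: (addIr (\sum_j g j (c j * x : R))).
    rewrite -[RHS]gE -big_split -[x in RHS](mul1r x) /=.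
    rewrite (eq_bigr (fun j => g j ((delta_mx 0 k : 'rV_r) 0 j * x : R))) => [|j _].
      rewrite (bigD1 k) //= mxE !eqxx big1 ?addr0 // => j /negPf jk.
      by rewrite mxE jk eqxx hom_mul0.
    by rewrite -hom_mulD cE !mxE subrK.
  exists f0 => h; have [c cP] := gP' h.
  have [b bP] : B (\row_k c k).
    rewrite (row_sum_delta (\row_k c k)); apply: submod_sum => // k _.
    by case: sB => _ _; apply.
  by exists b => x; rewrite cP -bP; apply: eq_bigr => k _; rewrite mxE.
apply: contrapT => nWh; have [n [y yP]] := fS.
(* The map a h + w -> a u, for w in W, on the vectors of values at the
   generators y of S: it is well defined modulo J because a map with values in
   J lies in m Hom(S, R). *)
pose G (v : 'rV[R]_n) (b : R) := exists (a : R) (w : {linear S -> R^o}),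
  [/\ W w, forall i, J (v 0 i - (a * h (y i) + w (y i))) & J (b - a * u)].
have [|b||mu [mulin muG]] :=
    quotient_self_injective (s' := s) (erefl _) regs (G := G) (finite_module_rV R n).
- move=> a v b v' b' [a1 [w1 [Ww1 J1 Jb]]] [a2 [w2 [Ww2 J2 Jb']]].
  exists (a * a1 + a2), ((a \*: w1) \+ w2); split.
  + exact: (WD _ _ (WZ a _ Ww1) Ww2).
  + move=> i; rewrite !mxE.
    have -> : a * v 0 i + v' 0 i - ((a * a1 + a2) * h (y i) + (a * w1 (y i) + w2 (y i))) =
      a * (v 0 i - (a1 * h (y i) + w1 (y i))) + (v' 0 i - (a2 * h (y i) + w2 (y i))).
      by ring.
    by apply: (JD) => //; exact: JZ.
  + have -> : a * b + b' - (a * a1 + a2) * u = a * (b - a1 * u) + (b' - a2 * u) by ring.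
    by apply: (JD) => //; exact: JZ.
- move=> [a [w [Ww Jv Jb]]].
  have ma : m a.
    apply: contrapT => ma; have [c ca] := local_unit noethR locR ma; apply: nWh.
    have [|g' g'E] := hom_into_mod_seq fS Ext_vanish_Fstar (s := s)
        (f := (a \*: h) \+ w) regs.
      move=> x; have [z ->] := yP x; rewrite linear_sum.
      apply: (big_ind J J0 JD) => i _; rewrite linearZ; apply: (JZ).
      by have := JZ (-1) _ (Jv i); rewrite mxE sub0r mulN1r opprK.
    have WJ : W (fun x => \sum_(i < size s) nth 0 s i * g' i x).
      have := fun i : 'I_(size s) => ms (mem_nth 0 (ltn_ord i)).
      elim: (size s) g' {g'E} => [|l IH] g' msi.
        by rewrite (_ : (fun _ => _) = (fun=> 0)) //; apply/funext => x; rewrite big_ord0.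
      rewrite (_ : (fun _ => _) = (fun x => \sum_(i < l) nth 0 s i *
          g' (widen_ord (leqnSn l) i) x + g' ord_max (nth 0 s l ^+ q * x : R))).
        apply: WD; first by apply: IH => i; exact: (msi (widen_ord (leqnSn l) i)).
        by apply/Wm/mq; exact: (msi ord_max).
      apply/funext => x; rewrite big_ord_recr; congr (_ + _).
      by rewrite -[_ ^+ q * x]/(nth 0 s l *: (x : S)) linearZ.
    suff -> : (h : S -> R) = (fun x => c * (\sum_(i < size s) nth 0 s i * g' i x
        + (-1) * w x)).
      by apply: (WZ); apply: (WD) => //; exact: (WZ).
    apply/funext => x; rewrite -g'E /= mulN1r addrK.
    by rewrite -[a *: h x]/(a * h x) mulrA ca mul1r.
  by rewrite -[b](subrK (a * u)); apply: (JD) => //; exact: muJ.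
- move=> a x Ja; exists 0, \0; split=> [||]; [exact: W0| |by rewrite mul0r subr0].
  move=> i; rewrite mxE mul0r add0r subr0 mulrC; exact: JZ.
(* The extension mu is, modulo J, evaluation at z. *)
pose z : S := \sum_i mu (delta_mx 0 i) *: y i.
have muE (k : {linear S -> R^o}) : J (mu (\row_i k (y i)) - k z).
  have := @linear_mod_sum R _ R^o J mu n (fun i => k (y i)) (fun i => delta_mx 0 i) ideal_J mulin.
  rewrite (eq_bigr (fun i => (\row_i k (y i)) 0 i *: delta_mx 0 i)) => [|i _]; last first.
    by rewrite mxE.
  rewrite -row_sum_delta => Jmu.
  rewrite /z linear_sum (eq_bigr (fun i => k (y i) * mu (delta_mx 0 i))) // => i _.
  by rewrite linearZ /= mulrC.
have kz a (w : {linear S -> R^o}) : W w -> J (a * h z + w z - a * u).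
  move=> Ww; have Jmu : J (mu (\row_i ((a \*: h) \+ w) (y i)) - a * u).
    apply: muG; exists a, w; split=> [//|i|]; last by rewrite subrr.
    by rewrite mxE subrr.
  have := JD _ _ (JZ (-1) _ (muE ((a \*: h) \+ w))) Jmu.
  by rewrite mulN1r opprB addrA subrK.
have hz : J (h z - u).
  by have := kz 1 \0 W0; rewrite !mul1r addr0.
have Wz (w : {linear S -> R^o}) : W w -> J (w z).
  by move=> /(kz 0); rewrite !mul0r add0r subr0.
have J'z : ~ J' z.
  move=> /(hom_mod_seq_frobenius h) Jhz; apply: Ju.
  by have := JD _ _ Jhz (JZ (-1) _ hz); rewrite mulN1r opprB addrC subrK.
have mz a : m a -> J' (a * z : R).
  move=> ma; apply: contrapT => /Fstar_torsionless [k Jk]; apply: Jk.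
  exact: (Wz (premul k a) (Wm _ _ ma)).
have [a Jzau'] := socle_cyclic size_s' regs' J'u' mu' mz.
have ma : ~ m a.
  move=> ma; apply: J'z; rewrite -[z](subrK (a * u' : R)).
  by apply: (J'D) => //; exact: mu'.
have [b ba] := local_unit noethR locR ma.
have Wf0 : W (premul f0 b).
  exists b, (fun=> 0); split=> // x; rewrite big1 ?addr0 // => k _; exact: hom_mul0.
apply: Jf0u'.
have Ju'bz : J' (u' - b * z).
  have aux (A B U Z : R) : U - B * Z = (- B) * (Z - A * U) + (1 - B * A) * U by ring.
  by rewrite (aux a b u' z) ba subrr mul0r addr0; exact: J'Z.
have := JD _ _ (hom_mod_seq_frobenius f0 Ju'bz) (Wz _ Wf0).
by rewrite linearB subrK.
Qed.

End Frobenius.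

End Depth.
End GorensteinComplex.

Section GorensteinFrobenius.
Variables (R : comNzRingType) (m : set R) (p : nat) (chRp : p \in [pchar R]).
Hypotheses (noethR : noetherian R) (locR : local_ring m) (gorR : gorenstein_local R).

Section Shift.
Variables (E : nat -> lmodType R) (dE : forall i, {linear E i -> E i.+1}).

Definition shift_module i : lmodType R := if i is j.+1 then E j else 'rV[R]_0.

Definition shift_map i : {linear shift_module i -> shift_module i.+1} :=
  match i return {linear shift_module i -> shift_module i.+1} with
  | 0 => \0
  | j.+1 => dE j
  end.
End Shift.

Variable e : nat.
Hypothesis fS : finite_module (Fstar chRp e : lmodType R).
Local Notation S := (Fstar chRp e).

Lemma gorenstein_Fstar :
  [/\ exists f0 : {linear S -> R^o}, forall h : {linear S -> R^o},
        exists b : R, forall x : R, h x = f0 (b * x : R),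
      forall (B : lmodType R) (pi : {linear R^o -> B}),
        surjective_map pi -> finite_projective_dimension B ->
        forall f : {linear S -> B}, exists h : {linear S -> R^o}, forall x, pi (h x) = f x &
      forall (B : lmodType R) (pi : {linear R^o -> B}),
        surjective_map pi -> finite_projective_dimension B ->
        forall f : {linear S -> R^o}, (forall x, pi (f x) = 0) ->
        exists r (a : 'I_r -> R) (g : 'I_r -> {linear S -> R^o}),
          (forall i, pi (a i) = 0) /\ forall x, f x = \sum_i a i * g i x].
Proof.
have [n [E [eta [dE [injE E0 eta_inj ex0 exS]]]]] := gorR.
pose C := shift_module E; pose d : forall i, {linear C i -> C i.+1} := shift_map dE.
have C0 (x : C 0%N) : x = 0 by rewrite [x]thinmx0.
have injC i : injective_module (C i).
  case: i => [|i]; last exact: injE.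
  by move=> A B f g _; exists \0 => x; rewrite [g x]C0.
have dd i (x : C i) : d i.+1 (d i x) = 0.
  by case: i x => [|i] x; [exact: linear0|apply/exS; exists x].
have deta : d 1%N (eta 1) = 0 by apply/ex0; exists 1.
have eta_gen (x : C 1%N) : d 1%N x = 0 -> exists a, x = a *: (eta 1 : C 1%N).
  by move=> /ex0 [a <-]; exists a; rewrite -linearZ; congr (eta _); exact: esym (mulr1 a).
have eta_free a : a *: (eta 1 : C 1%N) = 0 -> a = 0.
  rewrite -linearZ => ea; apply: eta_inj; rewrite linear0 -[RHS]ea.
  by congr (eta _); exact: esym (mulr1 a).
have exC i (x : C i.+2) : d i.+2 x = 0 -> exists y, x = d i.+1 y.
  by move=> /exS [y <-]; exists y.
have boundC i (x : C i) : (n.+1 < i)%N -> x = 0.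
  by case: i x => [//|i] x ni; apply: E0.
have [s [u [ms regs Ju muJ]]] :=
  maximal_regular_seq noethR locR.
have vS i : (0 < i)%N -> Ext_vanish d [set 0 : S] i.
  exact: (Ext_vanish_Fstar noethR locR injC dd C0 deta eta_gen eta_free exC boundC
    ms regs Ju muJ fS).
split.
- exact: (hom_Fstar_cyclic noethR locR injC dd C0 deta eta_gen eta_free exC boundC
    ms regs Ju muJ fS).
- move=> B pi spi pdB.
  exact: (finite_pd_lift noethR injC dd deta eta_gen eta_free exC fS vS spi pdB).
- move=> B pi spi pdB.
  exact: (finite_pd_hom_ideal noethR injC dd deta eta_gen eta_free exC fS vS spi pdB).
Qed.

End GorensteinFrobenius.

(** * Minimal primes of a quotient *)

Local Open Scope quotient_scope.

Section QuotientPrimes.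
Variables (R : comNzRingType) (Q : idealr R).
Local Notation RQ := {ideal_quot Q}.
Local Notation pr := (\pi_{ideal_quot Q}).
Local Notation Qs := ([set` Q] : set R).

Lemma pi_eqP (x y : R) : pr x = pr y <-> Qs (x - y).
Proof.
by split=> [/eqP|] /=; rewrite ?Quotient.idealrBE // => /eqP.
Qed.

Lemma pi_surj (y : RQ) : exists x, y = pr x.
Proof. by exists (repr y); rewrite reprK. Qed.

Lemma pi_eq0 (x : R) : pr x = 0 <-> Qs x.
Proof. by rewrite -[0](rmorph0 pr) pi_eqP subr0. Qed.

Lemma is_ideal_idealr : is_ideal Qs.
Proof.
split=> /= [|x y|a x]; [exact: rpred0|exact: rpredD|exact: idealMr].
Qed.

Definition ideal_preim (P : set RQ) : set R := [set x | P (pr x)].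
Definition ideal_img (P : set R) : set RQ := [set y | P (repr y)].

Lemma ideal_imgE (P : set R) x : is_ideal P -> Qs `<=` P -> ideal_img P (pr x) <-> P x.
Proof.
move=> idP QP; have /QP Px : Qs (repr (pr x) - x) by apply/pi_eqP; rewrite reprK.
split=> [Pr|Px'].
  by rewrite -[x](subKr (repr (pr x))); exact: (@submodB R R^o).
by rewrite /ideal_img /= -[repr _](subrK x); case: idP => _ D _; exact: D.
Qed.

Lemma prime_preim P : is_prime_ideal P -> is_prime_ideal (ideal_preim P).
Proof.
move=> [[P0 PD PZ] P1 PM]; split; [split| |]; rewrite /ideal_preim /=.
- by rewrite rmorph0.
- by move=> x y Px Py; rewrite rmorphD; exact: PD.
- by move=> a x Px; rewrite rmorphM; exact: PZ.
- by rewrite rmorph1.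
- by move=> x y; rewrite rmorphM; exact: PM.
Qed.

Lemma sub_preim P : is_ideal P -> Qs `<=` ideal_preim P.
Proof. by move=> [P0 _ _] x /pi_eq0 x0; rewrite /ideal_preim /= x0. Qed.

Lemma prime_img P : is_prime_ideal P -> Qs `<=` P -> is_prime_ideal (ideal_img P).
Proof.
move=> [idP P1 PM] QP; have [P0 PD PZ] := idP.
have imgE x := ideal_imgE x idP QP.
split; [split| |].
- by rewrite -(rmorph0 pr); apply/imgE.
- move=> x y; rewrite -[x]reprK -[y]reprK -rmorphD => /imgE Px /imgE Py.
  by apply/imgE; exact: PD.
- move=> a x; rewrite -[x]reprK -[a]reprK -rmorphM => /imgE Px.
  by apply/imgE; exact: PZ.
- by rewrite -(rmorph1 pr) => /imgE.
- move=> x y; rewrite -[x]reprK -[y]reprK -rmorphM => /imgE /PM [] Px.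
    by left; apply/imgE.
  by right; apply/imgE.
Qed.

Lemma outside_minimal_primes_quot (x : R) :
  outside_minimal_primes Qs x <-> outside_minimal_primes [set 0 : RQ] (pr x).
Proof.
split=> xout P [primeP QP minP] Px.
  have [idP _ _] := primeP; have primeP' := prime_preim primeP.
  apply: (xout (ideal_preim P)) => //; split=> //; first exact: sub_preim.
  move=> P' primeP1 QP' P'P; have [idP' _ _] := primeP1.
  have PE : ideal_img P' = P.
    apply: minP; first exact: prime_img.
      by move=> _ ->; rewrite -(rmorph0 pr); apply/ideal_imgE => //; case: idP'.
    by move=> y Py; rewrite -[y]reprK; exact: P'P.
  apply/seteqP; split=> [//|y]; rewrite /ideal_preim /= -PE.
  by move=> /(ideal_imgE y idP' QP').
have [idP _ _] := primeP.
apply: (xout (ideal_img P)); last exact/ideal_imgE.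
split; first exact: prime_img.
  by move=> _ ->; rewrite -(rmorph0 pr); apply/ideal_imgE => //; case: idP.
move=> P' primeP' _ P'P; have [idP' _ _] := primeP'.
have PE : ideal_preim P' = P.
  apply: minP; [exact: prime_preim|exact: sub_preim|].
  by move=> y /P'P /(ideal_imgE y idP QP).
apply/seteqP; split=> [//|y]; rewrite -[y]reprK => /(ideal_imgE _ idP QP).
by rewrite -{1}PE.
Qed.

End QuotientPrimes.

(** * Fedder's criterion *)

Section Fedder.
Variables (R : comNzRingType) (p : nat) (chRp : p \in [pchar R]).
Variables (m : set R) (Q : idealr R).
Hypotheses (noethR : noetherian R) (locR : local_ring m) (FfinR : F_finite chRp).
Local Notation RQ := {ideal_quot Q}.
Local Notation pr := (\pi_{ideal_quot Q}).
Local Notation Qs := ([set` Q] : set R).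
Local Notation q e := (p ^ e)%N.

Let q_gt0 e : (0 < q e)%N.
Proof. by rewrite expn_gt0 prime_gt0 // (pcharf_prime chRp). Qed.

Lemma frobenius_power_sub_I e : frobenius_power (q e) Qs `<=` I_ chRp e Qs.
Proof.
have [Q0 QD QZ] := is_ideal_idealr Q.
apply: smallest_sub => [|_ [x Qx <-] phi].
  split=> [phi|x y Ix Iy phi|a x Ix phi].
  - by rewrite linear0.
  - by rewrite /Fstar_elt linearD; apply: QD; [exact: Ix|exact: Iy].
  - exact: (Ix (premul phi a)).
rewrite -[Fstar_elt _ _ _]/(x ^+ q e : R) -[x ^+ q e]mulr1.
rewrite -[x ^+ q e * 1]/(x *: (1 : Fstar chRp e)) linearZ.
by have := QZ (phi 1) x Qx; rewrite mulrC.
Qed.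

Lemma F_finite_quot : F_finite (ideal_quot_pchar Q chRp).
Proof.
move=> e; have [n [g gP]] := FfinR e.
exists n, (fun i => pr (g i : R)) => y; have [c cE] := gP (repr (y : RQ)).
exists (fun i => pr (c i)); rewrite -[y in LHS](@reprK _ RQ) cE.
rewrite (rmorph_sum pr); apply: eq_bigr => i _.
by rewrite -[c i *: g i]/(c i ^+ q e * (g i : R)) rmorphM rmorphXn.
Qed.

(** [I_e(Q)] is the largest ideal that all maps [S -> R] send into [Q], so
    [phi (r .)] maps [Q] to itself. *)
Lemma colon_descends e r (phi : {linear Fstar chRp e -> R^o}) :
    colon (I_ chRp e Qs) Qs r ->
  exists theta : {linear Fstar (ideal_quot_pchar Q chRp) e -> RQ^o},
    forall x : R, theta (pr x) = pr (phi (r * x : R)).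
Proof.
move=> rQ.
pose th (y : RQ) : RQ := pr (phi (r * repr y : R)).
have thE x : th (pr x) = pr (phi (r * x : R)).
  apply/pi_eqP; rewrite -linearB; have -> : (r * repr (pr x) : R) - r * x = r * (repr (pr x) - x).
    by rewrite mulrBr.
  by apply: rQ; apply/pi_eqP; rewrite reprK.
have th_lin : linear (th : Fstar (ideal_quot_pchar Q chRp) e -> RQ^o).
  move=> a x y; have [a0 ->] := pi_surj a.
  have [x0 ->] := pi_surj (x : RQ); have [y0 ->] := pi_surj (y : RQ).
  have -> : pr a0 *: (pr x0 : Fstar (ideal_quot_pchar Q chRp) e) + pr y0 =
      pr (a0 ^+ q e * x0 + y0) by rewrite rmorphD rmorphM rmorphXn.
  by rewrite !thE mulrDr linearD rmorphD mulrCA mulrA hom_mulZ rmorphM.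
by exists (lin_of th_lin).
Qed.

Lemma colon_I_strongly_F_regular :
    (forall c, outside_minimal_primes Qs c -> exists2 e, (0 < e)%N &
      ~ (scale_set c (colon (I_ chRp e Qs) Qs) `<=` I_ chRp e m)) ->
  strongly_F_regular (ideal_quot_pchar Q chRp).
Proof.
move=> cond; split; first exact: F_finite_quot.
move=> c cout; have cout' : outside_minimal_primes Qs (repr c).
  by apply/outside_minimal_primes_quot; rewrite reprK.
have [e e0 /existsNP [_ /not_implyP [[r rQ <-] /existsNP [phi mphi]]]] := cond _ cout'.
exists e => //; have [theta thetaE] := colon_descends phi rQ.
have [b bphi] := local_unit noethR locR mphi.
exists (pr b \*: theta) => a.
have thc : theta c = pr (phi (repr c * r : R)).
  by rewrite -[c in LHS]reprK thetaE [_ * r]mulrC.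
rewrite linearZ /= [X in _ *: (_ *: X)]thc.
rewrite -[LHS]/(a * (pr b * _)) -rmorphM.
by rewrite bphi rmorph1 mulr1.
Qed.

Hypothesis gorR : gorenstein_local R.

Fact pi_module_linear : linear ((fun x => pr x) : R^o -> quot_module Q).
Proof. by move=> a x y; rewrite rmorphD rmorphM. Qed.

Lemma strongly_F_regular_colon :
    finite_projective_dimension (quot_module Q : lmodType R) ->
    strongly_F_regular (ideal_quot_pchar Q chRp) ->
  forall c, outside_minimal_primes Qs c -> exists2 e, (0 < e)%N &
    ~ (scale_set c (colon (frobenius_power (q e) Qs) Qs) `<=` I_ chRp e m).
Proof.
move=> pdQ [_ sFr] c /outside_minimal_primes_quot /sFr [e e0 [phi phic]].
exists e => //.
pose pi : {linear R^o -> quot_module Q} := lin_of pi_module_linear.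
have spi : surjective_map pi by move=> y; have [x ->] := pi_surj (y : RQ); exists x.
have pi0 x : pi x = 0 <-> Qs x by exact: pi_eq0.
have [[f0 f0P] liftP homP] := gorenstein_Fstar noethR locR gorR (FfinR e).
have phi_lin : linear (fun x : Fstar chRp e => phi (pr (x : R)) : quot_module Q).
  move=> a x y; rewrite rmorphD rmorphM rmorphXn.
  by rewrite -[_ * _]/(pr a *: (pr (x : R) : Fstar (ideal_quot_pchar Q chRp) e)) linearP.
have [h hE] := liftP _ pi spi pdQ (lin_of phi_lin).
have [r rE] := f0P h.
have mhc : ~ m (h (c : R)).
  have Q1 : Qs (h (c : R) - 1).
    apply/pi_eqP; rewrite rmorph1 -[LHS]/(pi _) hE /=.
    by have := phic 1; rewrite scale1r.
  move=> mhc; apply: (max_proper locR); have [_ mD mZ] := ideal_max locR.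
  have Qm : Qs `<=` m.
    by apply: (proper_sub_max noethR locR (is_ideal_idealr Q)); rewrite /= idealr1.
  have -> : 1 = h (c : R) + (- 1) * (h (c : R) - 1) by ring.
  by apply: mD => //; apply: mZ; exact: Qm.
(* [h (z ^+ q c) = z h (c)], and [h (c)] is a unit. *)
have f0_faithful z : (forall x : R, f0 (z * x : R) = 0) -> z = 0.
  move=> z0; have [b bhc] := local_unit noethR locR mhc.
  have: h (z ^+ q e * c : R) = 0.
    by rewrite rE -(prednK (q_gt0 e)) exprS mulrCA -mulrA; exact: z0.
  rewrite -[z ^+ q e * c]/(z *: (c : Fstar chRp e)) linearZ => zh.
  have zh' : z * h (c : R) = 0 by [].
  by rewrite -[z]mulr1 -bhc mulrCA zh' mulr0.
have rQ : colon (frobenius_power (q e) Qs) Qs r.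
  move=> w Qw.
  have [|k [a [g [Qa wE]]]] := homP _ pi spi pdQ (premul h w).
    move=> x; rewrite hE lin_ofE (_ : pr (w * x : R) = 0) ?linear0 //.
    by apply/pi_eq0; rewrite mulrC; exact: idealMr.
  have tex i : exists t : R, forall x : R, g i x = f0 (t * x : R) by exact: f0P.
  have [t tP] := choice tex.
  have -> : r * w = \sum_i t i * a i ^+ q e.
    apply/eqP; rewrite -subr_eq0; apply/eqP/f0_faithful => x.
    rewrite mulrBl linearB -mulrA -rE -[h _]/(premul h w x) wE.
    apply/eqP; rewrite subr_eq0; apply/eqP.
    rewrite mulr_suml linear_sum; apply: eq_bigr => i _.
    by rewrite tP (mulrC (t i) (a i ^+ q e)) hom_mulZ.
  have [F0 FD FZ] : is_ideal (frobenius_power (q e) Qs).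
    split=> [I [[]]//|x y Ix Iy I SI|b x Ix I SI].
      by have [[_ D _] _] := SI; apply: D; [exact: Ix|exact: Iy].
    by have [[_ _ Z] _] := SI; apply: Z; exact: Ix.
  apply: (big_ind _ F0 FD) => i _; apply: FZ => I [_ SI]; apply: SI.
  by exists (a i) => //; apply/pi0.
move=> /(_ (c * r)) cr; apply: mhc; rewrite rE mulrC.
by apply: cr; exists r.
Qed.

End Fedder.

Theorem corollary3p5 (R : comNzRingType) (p : nat) (chRp : p \in [pchar R])
    (m : set R) (noethR : noetherian R) (locR : local_ring m)
    (FfinR : F_finite chRp) (gorR : gorenstein_local R) (Q : idealr R) :
  let Qs : set R := [set` Q] in
  let cond1 : Prop :=
    forall c : R, outside_minimal_primes Qs c ->
      exists2 e : nat, (0 < e)%N &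
        ~ (scale_set c (colon (frobenius_power (p ^ e)%N Qs) Qs)
             `<=` I_ chRp e m) in
  let cond2 : Prop :=
    forall c : R, outside_minimal_primes Qs c ->
      exists2 e : nat, (0 < e)%N &
        ~ (scale_set c (colon (I_ chRp e Qs) Qs) `<=` I_ chRp e m) in
  let cond3 : Prop := strongly_F_regular (ideal_quot_pchar Q chRp) in
  [/\ cond1 -> cond2,
      cond2 -> cond3 &
      finite_projective_dimension (quot_module Q : lmodType R) ->
      cond3 -> cond1].
Proof.
move=> Qs cond1 cond2 cond3; split.
- move=> c1 c cout; have [e e0 H] := c1 c cout; exists e => // H'; apply: H.
  move=> _ [r rQ <-]; apply: H'; exists r => // x Qx.
  by apply: frobenius_power_sub_I; exact: rQ.
- exact: colon_I_strongly_F_regular.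
- exact: strongly_F_regular_colon.
Qed.
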